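(* Let $a,b,F,\dot I_0,\dot d_0,\dot z_1,\dot z_2,\dot z_3\in\mathbb C$. (1) If $F\ne0$, then $V(0,\dot d_0,\dot z_1,0,0)\otimes A'(a,b;F)$ is a simple $\mathcal L$-module. (2) $V(0,\dot d_0,\dot z_1,0,0)\otimes A'(a,b;0)$ is a simple $\mathcal L$-module if and only if $V(\dot d_0,\dot z_1)\otimes A'(a,b)$ is a simple $\mathrm{Vir}$-module. (3) Suppose $(\dot I_0,\dot z_2,\dot z_3)\ne(0,0,0)$ and $A(a,b;F)$ is simple. Then $V(\dot I_0,\dot d_0,\dot z_1,\dot z_2,\dot z_3)\otimes A(a,b;F)$ is simple if and only if $(\rho_n(\widetilde Q_1),\rho_n(\widetilde Q_2))\ne(0,0)$ for all $n\in\mathbb Z$. (4) Suppose $(\dot I_0,\dot z_2,\dot z_3)\ne(0,0,0)$ and $(a,b,F)=(0,0,0)$. Then $V(\dot I_0,\dot d_0,\dot z_1,\dot z_2,\dot z_3)\otimes A'(0,0;0)$ is simple if and only if $(\rho_n(\widetilde Q_1),\rho_n(\widetilde Q_2))\ne(0,0)$ for all $n\in\mathbb Z\setminus\{0\}$.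
   Context: $\mathcal{L}$ has basis $\{d_n,I_n,z_1,z_2,z_3\mid n\in\mathbb{Z}\}$ with brackets $[d_n,d_m]=(m-n)d_{m+n}+\delta_{n,-m}\frac{n^3-n}{12}z_1$, $[d_n,I_m]=mI_{m+n}+\delta_{n,-m}(n^2+n)z_2$, $[I_n,I_m]=n\delta_{n,-m}z_3$, $z_i$ central; $\mathrm{Vir}=\mathrm{span}\{d_i,z_1\}$. $\mathcal L^-=\mathrm{span}\{d_{-n},I_{-n}\mid n\in\mathbb N\}$, and $U(\mathcal L^-)_{-k}$ is the subspace of $U(\mathcal L^-)$ of degree $-k$ (degree of $d_i,I_i$ is $i$). The Verma module $M(\dot I_0,\dot d_0,\dot z_1,\dot z_2,\dot z_3)=U(\mathcal L)/\mathcal I$, with $\mathcal I$ the left ideal generated by $d_n,I_n$ ($n\in\mathbb N$), $d_0-\dot d_0$, $I_0-\dot I_0$, $z_i-\dot z_i$; $w=1+\mathcal I$; $V(\dot I_0,\dot d_0,\dot z_1,\dot z_2,\dot z_3)$ is its simple quotient. When $(\dot I_0,\dot z_2,\dot z_3)\ne(0,0,0)$, there are weight vectors (possibly zero) $\widetilde Q_1,\widetilde Q_2\in U(\mathcal L^-)$ such that the maximal proper submodule of $M(\dot I_0,\dot d_0,\dot z_1,\dot z_2,\dot z_3)$ equals $U(\mathcal L^-)\widetilde Q_1w+U(\mathcal L^-)\widetilde Q_2w$; these are fixed. For $n\in\mathbb Z$, $\rho_n:U(\mathcal L^-)\to\mathbb C$ is the linear map defined inductively by $\rho_n(1)=1$,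 $\rho_n(I_{-i}u)=-F\rho_n(u)$, $\rho_n(d_{-i}u)=-(a+k+i+n-ib)\rho_n(u)$ for $i\in\mathbb N$, $u\in U(\mathcal L^-)_{-k}$. $V(h,c)$ is the simple highest weight $\mathrm{Vir}$-module with highest weight $d_0=h$, $z_1=c$. $A(a,b;F)=\mathbb{C}[x,x^{-1}]$ with $z_1=z_2=z_3=0$, $d_nx^m=(a+m+nb)x^{m+n}$, $I_nx^m=Fx^{m+n}$; it is simple unless $a\in\mathbb Z$, $b\in\{0,1\}$, $F=0$, and $A'(a,b;F)$ is its unique nontrivial simple subquotient; $A'(a,b)$ is $A'(a,b;0)$ regarded as a $\mathrm{Vir}$-module. *)

(* Defs.v *)
From mathcomp Require Import all_boot all_order all_algebra.
From mathcomp Require Import complex Rstruct.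
Set Implicit Arguments.
Unset Strict Implicit.
Unset Printing Implicit Defensive.
Import Order.TTheory GRing.Theory Num.Theory.
Local Open Scope ring_scope.

Definition CC : fieldType := Rdefinitions.R[i].

(* A "module" is presented by a carrier type T, a predicate P on T
   cutting out the underlying vector space, its zero/addition/scaling,
   and a family of operators (the action of a basis of the Lie algebra).
   A submodule is a subspace of P stable under all operators.           *)

Section Generic.
Variables (C : fieldType) (T : Type) (P : T -> Prop) (z0 : T)
  (add : T -> T -> T) (scl : C -> T -> T) (O : Type) (ops : O -> T -> T).

Definition is_submod (W : T -> Prop) : Prop :=
  [/\ (forall x, W x -> P x), W z0,
      (forall x y, W x -> W y -> W (add x y)),
      (forall c x, W x -> W (scl c x)) &
      (forall o x, W x -> W (ops o x))].

Definition is_simple : Prop :=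
  (exists x, P x /\ x <> z0) /\
  forall W, is_submod W -> (forall x, W x -> x = z0) \/ (forall x, P x -> W x).
End Generic.

Inductive Lop := OD of int | OI of int | OZ1 | OZ2 | OZ3.
Inductive Virop := VD of int | VZ1.

Definition delta (n m : int) (C : fieldType) : C := if n == - m then 1 else 0.

Definition is_Lmodule (C : fieldType) (V : lmodType C) (act : Lop -> V -> V) : Prop :=
  [/\ (forall o (c : C) (x y : V), act o (c *: x + y) = c *: act o x + act o y),
      (forall (n m : int) (v : V),
          act (OD n) (act (OD m) v) - act (OD m) (act (OD n) v)
          = (m - n)%:~R *: act (OD (m + n)) v
            + (delta n m C * ((n ^+ 3 - n)%:~R / 12%:R)) *: act OZ1 v),
      (forall (n m : int) (v : V),
          act (OD n) (act (OI m) v) - act (OI m) (act (OD n) v)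
          = m%:~R *: act (OI (m + n)) v
            + (delta n m C * (n ^+ 2 + n)%:~R) *: act OZ2 v),
      (forall (n m : int) (v : V),
          act (OI n) (act (OI m) v) - act (OI m) (act (OI n) v)
          = (n%:~R * delta n m C) *: act OZ3 v) &
      (forall o o' (v : V), (o = OZ1 \/ o = OZ2 \/ o = OZ3) ->
          act o (act o' v) = act o' (act o v))].

Definition is_Virmodule (C : fieldType) (V : lmodType C) (act : Virop -> V -> V) : Prop :=
  [/\ (forall o (c : C) (x y : V), act o (c *: x + y) = c *: act o x + act o y),
      (forall (n m : int) (v : V),
          act (VD n) (act (VD m) v) - act (VD m) (act (VD n) v)
          = (m - n)%:~R *: act (VD (m + n)) v
            + (delta n m C * ((n ^+ 3 - n)%:~R / 12%:R)) *: act VZ1 v) &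
      (forall o' (v : V), act VZ1 (act o' v) = act o' (act VZ1 v))].

Definition Lsimple (C : fieldType) (V : lmodType C) (act : Lop -> V -> V) :=
  is_simple (fun _ : V => True) 0 +%R (@GRing.scale C V) act.
Definition Lsubmod (C : fieldType) (V : lmodType C) (act : Lop -> V -> V) :=
  is_submod (fun _ : V => True) 0 +%R (@GRing.scale C V) act.
Definition Virsubmod (C : fieldType) (V : lmodType C) (act : Virop -> V -> V) :=
  is_submod (fun _ : V => True) 0 +%R (@GRing.scale C V) act.

Definition hw_vector (C : fieldType) (V : lmodType C) (act : Lop -> V -> V)
    (w : V) (I0 d0 z1 z2 z3 : C) : Prop :=
  [/\ (forall n : int, 0 < n -> act (OD n) w = 0 /\ act (OI n) w = 0),
      act (OD 0) w = d0 *: w, act (OI 0) w = I0 *: w &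
      [/\ act OZ1 w = z1 *: w, act OZ2 w = z2 *: w & act OZ3 w = z3 *: w]].

Definition Lgenerated (C : fieldType) (V : lmodType C) (act : Lop -> V -> V) (w : V) :=
  forall W, Lsubmod act W -> W w -> forall x, W x.

Definition is_simple_hw (C : fieldType) (V : lmodType C) (act : Lop -> V -> V)
    (w : V) (I0 d0 z1 z2 z3 : C) : Prop :=
  [/\ is_Lmodule act, w <> 0, hw_vector act w I0 d0 z1 z2 z3,
      Lgenerated act w & Lsimple act].

(** (M, act, w) is (a realization of) the Verma module
    M(I0,d0,z1,z2,z3) = U(L)/I with w = 1 + I, characterized by its
    universal property. *)
Definition is_verma (C : fieldType) (M : lmodType C) (act : Lop -> M -> M)
    (w : M) (I0 d0 z1 z2 z3 : C) : Prop :=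
  [/\ is_Lmodule act, hw_vector act w I0 d0 z1 z2 z3, Lgenerated act w &
      forall (N : lmodType C) (actN : Lop -> N -> N) (v : N),
        is_Lmodule actN -> hw_vector actN v I0 d0 z1 z2 z3 ->
        exists phi : M -> N,
          [/\ (forall (c : C) x y, phi (c *: x + y) = c *: phi x + phi y),
              (forall o x, phi (act o x) = actN o (phi x)) & phi w = v]].

Definition is_simple_hw_Vir (C : fieldType) (V : lmodType C) (act : Virop -> V -> V)
    (w : V) (h c : C) : Prop :=
  [/\ is_Virmodule act, w <> 0,
      [/\ (forall n : int, 0 < n -> act (VD n) w = 0),
          act (VD 0) w = h *: w & act VZ1 w = c *: w],
      (forall W, Virsubmod act W -> W w -> forall x, W x) &
      is_simple (fun _ : V => True) 0 +%R (@GRing.scale C V) act].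

(** * U(L^-): formal linear combinations of words in d_{-i}, I_{-i}    *)

(** GD k stands for d_{-(k+1)}, GI k for I_{-(k+1)}. *)
Inductive gen := GD of nat | GI of nat.

Definition gen_deg (g : gen) : nat := match g with GD k => k.+1 | GI k => k.+1 end.
(** a word [g1; ...; gr] stands for the product g1 g2 ... gr; its degree is
    minus wdeg. *)
Definition wdeg (u : seq gen) : nat := \sum_(g <- u) gen_deg g.

Definition Usum (C : fieldType) := seq (C * seq gen).

Definition Uhomog (C : fieldType) (Q : Usum C) : Prop :=
  exists k, all (fun p => wdeg p.2 == k) Q.

Definition gact (C : fieldType) (V : lmodType C) (act : Lop -> V -> V) (g : gen) : V -> V :=
  match g with
  | GD k => act (OD (- (k.+1)%:Z))
  | GI k => act (OI (- (k.+1)%:Z))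
  end.

Definition wact (C : fieldType) (V : lmodType C) (act : Lop -> V -> V) (u : seq gen) (v : V) : V :=
  foldr (fun g x => gact act g x) v u.

Definition Uact (C : fieldType) (V : lmodType C) (act : Lop -> V -> V) (Q : Usum C) (v : V) : V :=
  \sum_(p <- Q) p.1 *: wact act p.2 v.

Fixpoint rho_word (C : fieldType) (a b F : C) (n : int) (u : seq gen) : C :=
  match u with
  | [::] => 1
  | GD k :: u' =>
      - (a + (wdeg u')%:R + (k.+1)%:R + n%:~R - (k.+1)%:R * b) * rho_word a b F n u'
  | GI k :: u' => - F * rho_word a b F n u'
  end.

Definition rho (C : fieldType) (a b F : C) (n : int) (Q : Usum C) : C :=
  \sum_(p <- Q) p.1 * rho_word a b F n p.2.

Definition maxsub_gen (C : fieldType) (M : lmodType C) (act : Lop -> M -> M) (w : M)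
    (Q1 Q2 : Usum C) : Prop :=
  let S := fun x : M => exists p1 p2 : Usum C,
             x = Uact act p1 (Uact act Q1 w) + Uact act p2 (Uact act Q2 w) in
  [/\ Lsubmod act S, (exists x, ~ S x) &
      forall W, Lsubmod act W -> (exists x, ~ W x) -> forall x, W x -> S x].

(** x^m is indexed by m : int.  A'(a,b;F): when A(a,b;F) is reducible
    (a in Z, b in {0,1}, F = 0) it is the module with basis x^m, m <> -a,
    and action d_n x^m = (a+m+nb) x^{m+n} if m+n <> -a, 0 otherwise
    (i.e. the simple subquotient); otherwise A'(a,b;F) = A(a,b;F).
    [exclA' a b F m] says that the index m is removed. *)
Definition exclA' (C : fieldType) (a b F : C) (m : int) : bool :=
  [&& F == 0, (b == 0) || (b == 1) & a + m%:~R == 0].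
Definition exclA (m : int) : bool := false.

Definition finsupp (T : Type) (z : T) (f : int -> T) : Prop :=
  exists s : seq int, forall m, m \notin s -> f m = z.

(** the module A(a,b;F) itself: finitely supported f : int -> C,
    f = sum_m f(m) x^m. *)
Definition Aop (C : fieldType) (a b F : C) (o : Lop) (g : int -> C) : int -> C :=
  fun m => match o with
           | OD n => (a + (m - n)%:~R + n%:~R * b) * g (m - n)
           | OI n => F * g (m - n)
           | _ => 0
           end.

Definition A_simple (C : fieldType) (a b F : C) : Prop :=
  is_simple (finsupp 0) (fun _ => 0) (fun f g m => f m + g m)
            (fun c f m => c * f m) (Aop a b F).

(** V (x) A^excl: an element  sum_m f(m) (x) x^m  is a finitely supported
    f : int -> V vanishing at excluded indices. *)
Definition tens_space (C : fieldType) (V : lmodType C) (excl : int -> bool)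
    (f : int -> V) : Prop :=
  finsupp 0 f /\ forall m, excl m -> f m = 0.

Definition tens_op (C : fieldType) (V : lmodType C) (act : Lop -> V -> V)
    (a b F : C) (excl : int -> bool) (o : Lop) (f : int -> V) : int -> V :=
  fun m => if excl m then 0 else
    match o with
    | OD n => act (OD n) (f m) + (a + (m - n)%:~R + n%:~R * b) *: f (m - n)
    | OI n => act (OI n) (f m) + F *: f (m - n)
    | OZ1 => act OZ1 (f m)
    | OZ2 => act OZ2 (f m)
    | OZ3 => act OZ3 (f m)
    end.

Definition tens_simple (C : fieldType) (V : lmodType C) (act : Lop -> V -> V)
    (a b F : C) (excl : int -> bool) : Prop :=
  is_simple (@tens_space C V excl) (fun _ => 0) (fun f g m => f m + g m)
            (fun c f m => c *: f m) (tens_op act a b F excl).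

Definition tens_op_Vir (C : fieldType) (V : lmodType C) (act : Virop -> V -> V)
    (a b : C) (excl : int -> bool) (o : Virop) (f : int -> V) : int -> V :=
  fun m => if excl m then 0 else
    match o with
    | VD n => act (VD n) (f m) + (a + (m - n)%:~R + n%:~R * b) *: f (m - n)
    | VZ1 => act VZ1 (f m)
    end.

Definition tens_simple_Vir (C : fieldType) (V : lmodType C) (act : Virop -> V -> V)
    (a b : C) (excl : int -> bool) : Prop :=
  is_simple (@tens_space C V excl) (fun _ => 0) (fun f g m => f m + g m)
            (fun c f m => c *: f m) (tens_op_Vir act a b excl).

(* Main.v *)
(** If [f = sum_m f(m) x^m] lies in a submodule [W] of [V (x) A], then d_i and I_i
    with [i] large kill every [f(m)] and act on the powers of [x] only, so
    polynomial combinations of such operators isolate each [f(m) x^(m+i)].  The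
    [v] such that [v x^m] is in [W] for all large [m] form an L-submodule of [V],
    hence every nonzero [W] contains [w x^m] for all large [m].

    One descends to all [m] by the I_n if F <> 0 and the I_n kill [V] (part 1).
    In parts 3 and 4, modulo the [w x^m] with [m > n] one has
    [(u w) x^(n + deg u) = rho_n(u) w x^n] for [u] in U(L^-); so [Q w = 0] and
    [rho_n(Q) <> 0] put [w x^n] in [W].  Conversely, if [rho_n] kills both
    generators, it descends from the Verma module to an L^- -morphism from [V] to
    the dual of [A], i.e. to an L^- -invariant functional on [V (x) A] which
    vanishes on the submodule generated by the [w x^m], [m > n], but not at
    [w x^n].  That [rho_n] is well defined on the Verma module is obtained from
    the universal property, by extending it to a highest weight vector of the
    module coinduced from the dual of [A].

    Part 2 holds because [V(0, d0, z1, 0, 0)] is the simple Vir-module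
    [V(d0, z1)] on which the I_n act by zero. *)

From HB Require Import structures.
Require Import Defs.
From mathcomp Require Import all_boot all_order all_algebra.
From mathcomp Require Import complex Rstruct.
From mathcomp Require Import boolp functions ring zify.
Set Implicit Arguments.
Unset Strict Implicit.
Unset Printing Implicit Defensive.
Import Order.TTheory GRing.Theory Num.Theory.
Local Open Scope ring_scope.

(** * The bracket and the induced module *)

Section Bracket.
Variable C : fieldType.
Implicit Types x y z : Lop.

(** A formal combination of basis elements. [brk x y t] is the value at [x, y] of the linear
    extension of [t], so identities in L are tested against families [t] and no vector space L is
    formed. *)
Definition bracket x y : seq (C * Lop) :=
  match x, y with
  | OD n, OD m => [:: ((m - n)%:~R, OD (m + n));
                      (delta n m C * ((n ^+ 3 - n)%:~R / 12%:R), OZ1)]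
  | OD n, OI m => [:: (m%:~R, OI (m + n)); (delta n m C * (n ^+ 2 + n)%:~R, OZ2)]
  | OI n, OD m => [:: (- n%:~R, OI (n + m)); (- (delta m n C * (m ^+ 2 + m)%:~R), OZ2)]
  | OI n, OI m => [:: (n%:~R * delta n m C, OZ3)]
  | _, _ => [::]
  end.

Definition brk (B : lmodType C) x y (t : Lop -> B) : B :=
  \sum_(p <- bracket x y) p.1 *: t p.2.

Lemma brkD (B : lmodType C) x y (s t : Lop -> B) :
  brk x y (fun a => s a + t a) = brk x y s + brk x y t.
Proof. by rewrite /brk -big_split; apply: eq_bigr => p _; rewrite scalerDr. Qed.

Lemma brkZ (B : lmodType C) x y c (t : Lop -> B) :
  brk x y (fun a => c *: t a) = c *: brk x y t.
Proof.
by rewrite /brk scaler_sumr; apply: eq_bigr => p _; rewrite !scalerA mulrC.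
Qed.

Lemma brkB (B : lmodType C) x y (s t : Lop -> B) :
  brk x y (fun a => s a - t a) = brk x y s - brk x y t.
Proof. by rewrite brkD -[RHS]/(_ + _) -scaleN1r -brkZ; congr (_ + _); apply: eq_bigr => p _; rewrite scaleN1r. Qed.

Lemma brk_swap (B : lmodType C) x y x' y' (t : Lop -> Lop -> B) :
  brk x y (fun a => brk x' y' (t a)) = brk x' y' (fun b => brk x y (t^~ b)).
Proof.
rewrite /brk; under eq_bigr do rewrite scaler_sumr.
rewrite exchange_big; apply: eq_bigr => q _; rewrite scaler_sumr.
by apply: eq_bigr => p _; rewrite !scalerA mulrC.
Qed.

Lemma eq_deltaN (n m : int) : delta n m C = delta m n C.
Proof. by rewrite /delta -eqr_oppLR eq_sym. Qed.

Lemma brkC (B : lmodType C) x y (t : Lop -> B) : brk x y t = - brk y x t.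
Proof.
case: x y => [n|n|||] [m|m|||]; rewrite /brk /= ?big_nil ?oppr0 // !big_cons !big_nil /= !addr0.
- rewrite [m + n]addrC eq_deltaN /delta.
  case: eqP => [->|_]; last by rewrite !mul0r !scale0r !addr0 -scaleNr; congr (_ *: _); ring.
  rewrite opprD -!scaleNr; congr (_ *: _ + _ *: _); ring.
- by rewrite [m + n]addrC eq_deltaN opprD -!scaleNr !opprK.
- by rewrite [n + m]addrC opprD -!scaleNr eq_deltaN.
- rewrite eq_deltaN /delta.
  case: eqP => [->|_]; last by rewrite !mulr0 !scale0r oppr0.
  by rewrite -scaleNr; congr (_ *: _); ring.
Qed.

Lemma deltaE (n m s : int) : n + m = s -> delta n m C = (s == 0)%:R.
Proof. by move=> <-; rewrite /delta addr_eq0; case: eqP. Qed.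

(** The noncentral coefficients agree identically. The central ones matter only when n + m + k = 0,
    where the cocycle identities become polynomial identities in n and m. *)
Lemma jacobi (B : lmodType C) x y z (t : Lop -> B) :
  brk x y (fun a => brk a z t) = brk y z (fun b => brk x b t) + brk x z (fun a => brk a y t).
Proof.
case: x y z => [n|n|||] [m|m|||] [k|k|||];
 rewrite /brk /= ?big_nil ?addr0 // ?big_cons ?big_nil /= ?big_cons ?big_nil /= ?scaler0 ?addr0 ?add0r //.
all: rewrite ?scaler0 ?addr0 ?add0r ?scalerDr ?scalerA.
all: rewrite ?scaler0 ?addr0 ?add0r.
all: try (rewrite addrACA -!scalerDl).
all: have e1 : k + (m + n) = n + m + k by ring.
all: have e2 : k + m + n = n + m + k by ring.
all: have e3 : m + (k + n) = n + m + k by ring.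
all: have e4 : n + (k + m) = n + m + k by ring.
all: have e5 : m + n + k = n + m + k by ring.
all: have e6 : k + n + m = n + m + k by ring.
all: have e7 : m + k + n = n + m + k by ring.
all: have e8 : n + k + m = n + m + k by ring.
all: have e9 : n + (m + k) = n + m + k by ring.
all: have e10 : m + (n + k) = n + m + k by ring.
all: have e11 : k + (n + m) = n + m + k by ring.
all: rewrite ?e1 ?e2 ?e3 ?e4 ?e6 ?e7 ?e8 ?e5 -?scalerDl ?(deltaE e1) ?(deltaE e2) ?(deltaE e3) ?(deltaE e4) ?(deltaE e5) ?(deltaE e6) ?(deltaE e7) ?(deltaE e8) ?(deltaE e9) ?(deltaE e10) ?(deltaE e11) ?(deltaE (erefl (n + m + k))).
(* Here the left side is 0; it is written as a multiple of [t OZ3] so that coefficients can be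
   compared. *)
7: rewrite -[LHS](scale0r (t OZ3)).
all: try congr (_ + _); congr (_ *: _).
all: case: (n + m + k =P 0) => [h|_] /=.
all: try (have -> : k = - (n + m) by rewrite -[k]subr0 -h; ring).
all: try by ring.
Qed.

Definition neg x : bool :=
  match x with OD n | OI n => n < 0 | _ => false end.

Lemma eq_brk (B : lmodType C) x y (s t : Lop -> B) : s =1 t -> brk x y s = brk x y t.
Proof. by move=> e; apply: eq_bigr => p _; rewrite e. Qed.

(** L^- is a subalgebra: the central term is present in the list, but n + m < 0 makes its
    coefficient 0. *)
Lemma eq_brk_neg (B : lmodType C) x y (s t : Lop -> B) :
  neg x -> neg y -> (forall a, neg a -> s a = t a) -> brk x y s = brk x y t.
Proof.
case: x y => [n|n|||] [m|m|||] //= n0 m0 e; rewrite /brk /= !big_cons !big_nil /= !addr0.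
all: try have -> : delta n m C = 0 by rewrite /delta; case: eqP => //; lia.
all: try have -> : delta m n C = 0 by rewrite /delta; case: eqP => //; lia.
all: rewrite ?mul0r ?mulr0 ?oppr0 ?scale0r // !addr0 e //=; lia.
Qed.

Lemma eq_brk_nneg (B : lmodType C) x y (s t : Lop -> B) :
  ~~ neg x -> ~~ neg y -> (forall a, ~~ neg a -> s a = t a) -> brk x y s = brk x y t.
Proof.
case: x y => [n|n|||] [m|m|||] //= n0 m0 e; rewrite /brk /= ?big_cons !big_nil /= ?addr0 //.
all: by rewrite !e //=; lia.
Qed.

Section Induced.
Variables (B : lmodType C) (lam : Lop -> C).

(* [transp x] is the transpose of the left action of [x] on the induced module,
   written on functions of words in negative letters: a nonnegative [x] moves
   right through the word, [x g u = [x, g] u + g x u], until it meets the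
   highest weight vector, on which it acts by [lam x]. *)
Fixpoint transp (x : Lop) (f : seq Lop -> B) (u : seq Lop) : B :=
  if neg x then f (x :: u) else
  match u with
  | [::] => lam x *: f [::]
  | g :: u' => brk x g (fun y => transp y f u') + transp x (fun w => f (g :: w)) u'
  end.

Lemma transp_neg x f : neg x -> transp x f = fun u => f (x :: u).
Proof. by move=> nx; apply: funext => -[|g u] /=; rewrite nx. Qed.

Lemma transp_nil x f : ~~ neg x -> transp x f [::] = lam x *: f [::].
Proof. by move=> /negbTE /= ->. Qed.

Lemma transp_cons x f g u : ~~ neg x ->
  transp x f (g :: u) = brk x g (fun y => transp y f u) + transp x (fun w => f (g :: w)) u.
Proof. by move=> /negbTE /= ->. Qed.

Lemma eq_transp x f f' u : all neg u -> (forall w, all neg w -> f w = f' w) ->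
  transp x f u = transp x f' u.
Proof.
elim: u x f f' => [|g u IH] x f f' /= nu e; case nx: (neg x); rewrite ?e //= ?nx //.
case/andP: nu => ng nu; rewrite (IH _ _ (fun w => f' (g :: w))) //.
  by congr (_ + _); apply: eq_brk => y; apply: IH.
by move=> w nw; apply: e; rewrite /= ng.
Qed.

Lemma transp_linear x c (f f' : seq Lop -> B) u :
  transp x (fun w => c *: f w + f' w) u = c *: transp x f u + transp x f' u.
Proof.
elim: u x f f' => [|g u IH] x f f' /=; case nx: (neg x) => //.
  by rewrite !scalerDr !scalerA mulrC.
rewrite IH -[in LHS](eq_brk _ _ (fun y => esym (IH y f f'))) brkD brkZ.
by rewrite scalerDr addrACA.
Qed.


Lemma transp_0 x u : transp x (fun=> 0) u = 0.
Proof.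
have := transp_linear x (-1) (fun=> 0) (fun=> 0) u.
by under eq_fun do rewrite scaler0 addr0; rewrite scaleN1r addNr.
Qed.

Lemma transp_brk x y z (f : Lop -> seq Lop -> B) u :
  transp x (fun w => brk y z (f^~ w)) u = brk y z (fun a => transp x (f a) u).
Proof.
rewrite /brk; elim: (bracket y z) => [|p s IH].
  by under eq_fun do rewrite big_nil; rewrite big_nil transp_0.
under eq_fun do rewrite big_cons.
by rewrite transp_linear big_cons IH.
Qed.

Lemma transp_B x (f f' : seq Lop -> B) u :
  transp x (fun w => f w - f' w) u = transp x f u - transp x f' u.
Proof.
have -> : (fun w => f w - f' w) = fun w => -1 *: f' w + f w.
  by apply: funext => w; rewrite scaleN1r addrC.
by rewrite transp_linear scaleN1r addrC.
Qed.

Lemma transp_comp x (L : {linear B -> B}) f u :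
  transp x (fun w => L (f w)) u = L (transp x f u).
Proof.
elim: u x f => [|g u IH] x f /=; case nx: (neg x) => //=; first by rewrite linearZ.
rewrite (IH _ (fun w => f (g :: w))) linearD; congr (_ + _).
by rewrite /brk linear_sum; apply: eq_bigr => p _; rewrite IH linearZ.
Qed.

Hypothesis Hlam : forall x y, ~~ neg x -> ~~ neg y -> brk x y (lam : Lop -> C^o) = 0.

(* [f] is a function on U(L^-) *)
Definition is_dual (f : seq Lop -> B) := forall u g h v,
  all neg (u ++ g :: h :: v) ->
  f (u ++ g :: h :: v) - f (u ++ h :: g :: v) = brk g h (fun a => f (u ++ a :: v)).

Lemma is_dual_cons x f : neg x -> is_dual f -> is_dual (fun w => f (x :: w)).
Proof.
by move=> nx Hf u g h v nv; have := Hf (x :: u) g h v; rewrite /= nx; apply.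
Qed.

Lemma transp_comm_mix x g f u : ~~ neg x -> neg g ->
  transp g (transp x f) u - transp x (transp g f) u = brk x g (fun a => transp a f u).
Proof.
by move=> nx ng; rewrite !(transp_neg _ ng) transp_cons // addrK.
Qed.

(** Transposition reverses products, so both sides stand for f([x, y] u). If x or y is negative,
    this is the rule defining [transp] or the relation [is_dual]; otherwise both are moved past the
    first letter and the induction hypothesis applies. *)
Lemma transp_comm x y f u : is_dual f -> all neg u ->
  transp y (transp x f) u - transp x (transp y f) u = brk x y (fun a => transp a f u).
Proof.
elim: u x y f => [|g u IH] x y f Hf nu;
  (case: (boolP (neg x)) => nx; case: (boolP (neg y)) => ny;
   [ rewrite !transp_neg // (Hf [::]) ?[all _ _]/= ?nx ?ny //;
     apply: eq_brk_neg => // a na; by rewrite transp_neg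
   | by rewrite brkC -transp_comm_mix // opprB
   | by rewrite transp_comm_mix // | ]).
  (* At the highest weight vector the scalars [lam x] and [lam y] commute, and [lam] vanishes on
     [x, y] by [Hlam]. *)
  rewrite !transp_nil // !scalerA mulrC subrr.
  rewrite (eq_brk_nneg nx ny (t := fun a => lam a *: f [::])); last by move=> a na; rewrite transp_nil.
  transitivity (brk x y (lam : Lop -> C^o) *: f [::]); first by rewrite Hlam // scale0r.
  by rewrite /brk scaler_suml; apply: eq_bigr => p _; rewrite scalerA.
case/andP: nu => ng nu.
have ET z t : ~~ neg z -> transp z (transp t f) (g :: u) = brk z g (fun b => transp b (transp t f) u) + transp z (fun w => transp t f (g :: w)) u.
  by move=> nz; rewrite transp_cons.
have E2 z t : ~~ neg z -> ~~ neg t -> transp z (fun w => transp t f (g :: w)) u =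
   brk t g (fun a => transp z (transp a f) u) + transp z (transp t (fun w => f (g :: w))) u.
  move=> nz nt; under eq_fun do rewrite transp_cons // addrC -[transp t _ _]scale1r.
  by rewrite transp_linear scale1r addrC (transp_brk _ _ _ (fun a => transp a f)).
rewrite !ET // !E2 //.
rewrite (eq_brk_nneg nx ny (t := fun a => brk a g (fun b => transp b f u) + transp a (fun w => f (g :: w)) u)); last first.
  by move=> a na; rewrite transp_cons.
rewrite brkD -(IH x y (fun w => f (g :: w))) //; last first.
  exact: is_dual_cons.
(* [[x, y], g] splits into [x, [y, g]] + [[x, g], y]; the induction hypothesis for these two pairs
   yields the terms obtained by moving [x] and [y] past [g]. *)
rewrite jacobi.
rewrite -(eq_brk _ _ (fun b => IH x b f Hf nu)) -(eq_brk _ _ (fun b => IH b y f Hf nu)) !brkB.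
set A1 := brk y g _; set A2 := brk x g _; set A3 := brk x g _; set A4 := brk y g _.
rewrite (addrCA A3) !opprD addrACA [X in _ + X = _]addrACA. exact: addrA.
Qed.

(** Induction on the prefix [u]. The essential case is a nonnegative [x] that meets the two
    exchanged letters first; there the Jacobi identity and [transp_comm] account for [x, [g, h]]. *)
Lemma is_dual_transp x f : is_dual f -> is_dual (transp x f).
Proof. 
move=> Hf u; elim: u x f Hf => [|g' u IH] x f Hf g h v nu.
all: case: (boolP (neg x)) => nx; first by rewrite (transp_neg _ nx); apply: is_dual_cons.
all: rewrite ?cat0s ?cat_cons in nu *.
  have [ng [nh nv]] : neg g /\ neg h /\ all neg v by case/and3P: nu.
  rewrite !transp_cons //.
  rewrite (eq_brk g h (fun a => transp_cons f a v nx)) brkD.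
  have -> : brk g h (fun a => transp x (fun w => f (a :: w)) v) =
    transp x (fun w => f (g :: h :: w)) v - transp x (fun w => f (h :: g :: w)) v.
    rewrite -transp_B -(transp_brk _ _ _ (fun a w => f (a :: w))); apply: eq_transp => // w nw.
    by have := Hf [::] g h w; rewrite /= ng nh nw => ->.
  have -> : brk g h (fun a => brk x a (fun y => transp y f v)) =
     brk x g (fun y => transp y f (h :: v) - transp y (fun w => f (h :: w)) v)
     + brk x h (fun y => transp y (fun w => f (g :: w)) v - transp y f (g :: v)).
    have := jacobi x g h (fun y => transp y f v) => /eqP; rewrite -subr_eq => /eqP <-.
    rewrite -[X in _ + X]scaleN1r -brkZ; congr (_ + _); apply: eq_brk => y.
      by rewrite -transp_comm // !(transp_neg _ nh).
    by rewrite scaleN1r -brkC -transp_comm // !(transp_neg _ ng).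
  rewrite !brkB; set A1 := brk x g _; set A2 := brk x h _; set A3 := brk x g _; set A4 := brk x h _.
  rewrite ![_ + (_ + transp _ _ _)]addrA opprD addrACA; congr (_ + _).
  by rewrite [A4 + A3]addrC opprD addrACA.
have {nu} [ng nu] : neg g' /\ all neg (u ++ g :: h :: v) by apply/andP.
rewrite !transp_cons // opprD addrACA -brkB.
rewrite (IH x _ (is_dual_cons ng Hf)) //.
rewrite (eq_brk _ _ (fun y => IH y f Hf g h v nu)).
rewrite brk_swap -brkD; apply: eq_brk_neg.
- by move: nu; rewrite all_cat => /and4P[].
- by move: nu; rewrite all_cat => /and4P[].
- by move=> a na; rewrite transp_cons.
Qed.

End Induced.
End Bracket.

(** * The coinduced module and the Verma module *)

Section Modules.
Variable C : fieldType.

Lemma LmoduleP (V : lmodType C) (act : Lop -> V -> V) :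
  is_Lmodule act <->
  (forall o, linear (act o)) /\
  (forall x y v, act x (act y v) - act y (act x v) = brk x y (fun a => act a v)).
Proof.
split=> [[lin DD DI II ZZ]|[lin comm]]; split=> //.
- have Z o o' v : (o = OZ1 \/ o = OZ2 \/ o = OZ3) -> act o (act o' v) - act o' (act o v) = 0.
    by move=> h; rewrite ZZ // subrr.
  have Z' o o' v : (o' = OZ1 \/ o' = OZ2 \/ o' = OZ3) -> act o (act o' v) - act o' (act o v) = 0.
    by move=> h; rewrite (ZZ o' o v h) subrr.
  case=> [n|n|||] [m|m|||] v; rewrite /brk /= ?big_cons big_nil ?addr0.
  all: try by (apply: Z; auto).
  all: try by (apply: Z'; auto).
  + exact: DD.
  + exact: DI.
  + by rewrite -opprB DI opprD -!scaleNr.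
  + exact: II.
- by move=> n m v; rewrite comm /brk /= !big_cons big_nil addr0.
- by move=> n m v; rewrite comm /brk /= !big_cons big_nil addr0.
- by move=> n m v; rewrite comm /brk /= !big_cons big_nil addr0.
- move=> o o' v h; apply/eqP; rewrite -subr_eq0 comm /brk.
  by case: h => [->|[->|->]] /=; rewrite big_nil.
Qed.

Section Coinduced.
Variables (a b F : C).

(** The contragredient action on the full dual of A(a,b;F), a functional being recorded by its
    values on the x^m: (x phi)(x^m) = - phi(x x^m). *)
Definition Adual (x : Lop) (phi : int -> C^o) : int -> C^o := fun m =>
  match x with
  | OD i => - (a + m%:~R + i%:~R * b) * phi (m + i)
  | OI i => - F * phi (m + i)
  | _ => 0
  end.

Lemma Adual_linear x : linear (Adual x).
Proof.
move=> c f g; apply: funext => m; rewrite !fctE /= /Adual.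
by case: x => [i|i|||]; rewrite /= /GRing.scale /=; ring.
Qed.

HB.instance Definition _ x := GRing.isLinear.Build C (int -> C^o) (int -> C^o) _ (Adual x) (Adual_linear x).

Lemma Adual_comm x y phi :
  Adual x (Adual y phi) - Adual y (Adual x phi) = brk x y (fun z => Adual z phi).
Proof.
apply: funext => m; rewrite /brk.
case: x y => [n|n|||] [k|k|||] /=; rewrite ?big_cons big_nil !fctE /= /Adual.
all: rewrite ?scaler0 -?[(0 : int -> C^o) m]/(0 : C) ?addr0 ?mulr0 ?subr0 ?oppr0 //.
all: rewrite ?addrA ?[m + n + k]addrAC /GRing.scale /=; ring.
Qed.

(* The module coinduced from L^- to L by the dual of [A]: L^- -equivariant
   functions of words in L, on which L acts by right translation. *)
Definition coindP (nu : seq Lop -> int -> C^o) : Prop :=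
  (forall X x y Y, nu (X ++ x :: y :: Y) - nu (X ++ y :: x :: Y)
                   = brk x y (fun z => nu (X ++ z :: Y))) /\
  (forall g X, neg g -> nu (g :: X) = Adual g (nu X)).

Definition coind : {pred (seq Lop -> int -> C^o)} := [pred nu | `[< coindP nu >]].

Lemma coind_submod : submod_closed coind.
Proof.
split=> [|c nu nu' /asboolP[r l] /asboolP[r' l']]; apply/asboolP; split=> [X x y Y|g X ng].
- by rewrite /brk big1 => [|p _]; [exact: subrr | exact: scaler0].
- exact/esym/linear0.
- rewrite (eq_brk _ _ (t := fun z => c *: nu (X ++ z :: Y) + nu' (X ++ z :: Y))) //.
  by rewrite brkD brkZ -r -r' scalerBr addrACA -opprD.
- by rewrite [LHS]/(c *: nu (g :: X) + nu' (g :: X)) l // l' // linearP.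
Qed.

HB.instance Definition _ := GRing.isSubmodClosed.Build C (seq Lop -> int -> C^o) coind coind_submod.

Record coind_type := Coind { coind_val :> seq Lop -> int -> C^o; _ : coind_val \in coind }.
HB.instance Definition _ := [isSub for coind_val].
HB.instance Definition _ := [Choice of coind_type by <:].
HB.instance Definition _ := [SubChoice_isSubLmodule of coind_type by <:].


Lemma coind_comm (nu : coind_type) X x y Y :
  nu (X ++ x :: y :: Y) - nu (X ++ y :: x :: Y) = brk x y (fun z => nu (X ++ z :: Y)).
Proof. by have /asboolP[] := valP nu. Qed.

Lemma coind_neg (nu : coind_type) g X : neg g -> nu (g :: X) = Adual g (nu X).
Proof. by have /asboolP[_] := valP nu; apply. Qed.

Lemma coind_act_subproof x (nu : coind_type) : (fun X => nu (rcons X x)) \in coind.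
Proof.
apply/asboolP; split=> [X y z Y|g X ng]; last exact: coind_neg.
by rewrite !rcons_cat /= coind_comm; apply: eq_brk => t; rewrite rcons_cat.
Qed.

Definition coind_act x nu : coind_type := Coind (coind_act_subproof x nu).

Lemma coind_Lmodule : is_Lmodule coind_act.
Proof.
apply/LmoduleP; split=> [x c nu nu'|x y nu]; apply: val_inj => //.
apply: funext => X; transitivity (nu (X ++ [:: x; y]) - nu (X ++ [:: y; x])).
  by rewrite -[X ++ _]cat_rcons -[X ++ [:: y; x]]cat_rcons !cats1.
rewrite coind_comm /brk.
elim/big_rec2: _ => // p nu1 nu2 _ ->.
by rewrite cats1.
Qed.

Variables (I0 d0 z1 z2 z3 : C).

Definition hw_char (x : Lop) : C :=
  match x with
  | OD n => if n == 0 then d0 else 0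
  | OI n => if n == 0 then I0 else 0
  | OZ1 => z1 | OZ2 => z2 | OZ3 => z3
  end.

(** On d_i and I_i the character can be nonzero only for i = 0, and central terms need n = - m. In
    nonnegative degrees both force n = m = 0, where all structure constants vanish. *)
Lemma hw_char_brk x y : ~~ neg x -> ~~ neg y -> brk x y (hw_char : Lop -> C^o) = 0.
Proof.
case: x y => [n|n|||] [m|m|||] //= n0 m0; rewrite /brk /= ?big_cons !big_nil /= ?addr0 //.
all: have e k l : k >= 0 -> l >= 0 -> delta k l C = (k == 0)%:R * (l == 0)%:R by move=> k0 l0; rewrite /delta; case: eqP; do 2 case: eqP; try lia; move=> *; rewrite ?mulr0 ?mulr1 ?mul0r.
all: rewrite ?e /GRing.scale /=; try lia.
all: case: (n =P 0) => hn; case: (m =P 0) => hm; try (case: eqP => hs); try lia; subst; rewrite /=; try ring.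
Qed.

Lemma hw_vectorP (V : lmodType C) (act : Lop -> V -> V) (w : V) :
  hw_vector act w I0 d0 z1 z2 z3 <-> forall x, ~~ neg x -> act x w = hw_char x *: w.
Proof.
split=> [[pos D0 J0 [Z1 Z2 Z3]] [n|n|||] //= n0|H].
1,2: case: eqP => [->|/eqP nz] //; have /pos[] : (0 < n)%R by lia.
1,2: by rewrite scale0r.
split; [|exact: (H (OD 0))|exact: (H (OI 0))|split].
- move=> n n0; rewrite !H /=; try lia.
  have /eqP/negbTE -> : n <> 0 by lia.
  by rewrite !scale0r.
- exact: (H OZ1).
- exact: (H OZ2).
- exact: (H OZ3).
Qed.

Variable n : int.

Definition delta_fun : int -> C^o := fun m => (m == n)%:R.

(* [dual_word u m] is, up to grading, [rho_n u]. *)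
Definition dual_word (u : seq Lop) : int -> C^o := foldr (fun x phi => Adual x phi) delta_fun u.

Lemma dual_word_is_dual : is_dual dual_word.
Proof.
move=> u g h v _; elim: u => [|x u IH] /=; first exact: Adual_comm.
rewrite -[LHS]linearB /= IH /brk linear_sum.
by apply: eq_bigr => p _; rewrite linearZ.
Qed.

(** The word X is applied to the highest weight vector of the induced module and the result is
    evaluated by [dual_word]. The fold starts from the left because [transp y (transp x f) u] stands
    for f(x y u). *)
Definition hw_coind (X : seq Lop) : int -> C^o :=
  foldl (fun f x => transp hw_char x f) dual_word X [::].

Lemma is_dual_foldl X (f : seq Lop -> int -> C^o) : is_dual f -> is_dual (foldl (fun f x => transp hw_char x f) f X).
Proof. by elim: X f => [|x X IH] f //= Hf; apply: IH; apply: is_dual_transp => //; exact: hw_char_brk. Qed.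

Lemma eq_foldl_transp X (f f' : seq Lop -> int -> C^o) u : all neg u -> (forall w, all neg w -> f w = f' w) ->
  foldl (fun f x => transp hw_char x f) f X u = foldl (fun f x => transp hw_char x f) f' X u.
Proof.
elim: X f f' => [|x X IH] f f' nu e /=; first exact: e.
by apply: IH => // w nw; apply: eq_transp.
Qed.

Lemma foldl_transp_brk X y z (f : Lop -> seq Lop -> int -> C^o) u :
  foldl (fun f x => transp hw_char x f) (fun w => brk y z (f^~ w)) X u =
  brk y z (fun a => foldl (fun f x => transp hw_char x f) (f a) X u).
Proof.
elim: X f => [|x X IH] f //=; rewrite -(IH (fun a => transp hw_char x (f a))); congr (foldl _ _ X u).
by apply: funext => w; rewrite transp_brk.
Qed.

Lemma foldl_transp_B X (f f' : seq Lop -> int -> C^o) u :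
  foldl (fun f x => transp hw_char x f) (fun w => f w - f' w) X u =
  foldl (fun f x => transp hw_char x f) f X u - foldl (fun f x => transp hw_char x f) f' X u.
Proof.
elim: X f f' => [|x X IH] f f' //=; rewrite -IH; congr (foldl _ _ X u).
by apply: funext => w; rewrite transp_B.
Qed.

Lemma foldl_transp_Adual X g (f : seq Lop -> int -> C^o) u :
  foldl (fun f x => transp hw_char x f) (fun w => Adual g (f w)) X u =
  Adual g (foldl (fun f x => transp hw_char x f) f X u).
Proof.
elim: X f => [|x X IH] f //=; rewrite -IH; congr (foldl _ _ X u).
by apply: funext => w; rewrite transp_comp.
Qed.

(** The commutation relations come from [transp_comm]. Equivariance holds because a negative first
    letter applies [Adual], which acts on values and so commutes with the transposes. *)
Lemma hw_coindP : hw_coind \in coind.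
Proof.
apply/asboolP; split=> [X x y Y|g X ng]; rewrite /hw_coind.
  under [RHS]eq_brk do rewrite foldl_cat /=.
  rewrite !foldl_cat /= -foldl_transp_B -foldl_transp_brk; apply: eq_foldl_transp => // w nw.
  by rewrite transp_comm //; [exact: hw_char_brk | exact/is_dual_foldl/dual_word_is_dual].
by rewrite /= transp_neg // -foldl_transp_Adual.
Qed.

(* Freeness of the Verma module over U(L^-), in the only form needed: [rho_n]
   is well defined on it. *)
Lemma verma_dual (M : lmodType C) (act : Lop -> M -> M) (w : M) :
  is_verma act w I0 d0 z1 z2 z3 ->
  exists phi : M -> int -> C^o,
    [/\ linear phi,
        forall g x, neg g -> phi (act g x) = Adual g (phi x) &
        phi w = delta_fun].
Proof.
case=> _ _ _ univ.
have [|phi [lin com pw]] := univ coind_type coind_act (Coind hw_coindP) coind_Lmodule.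
  apply/hw_vectorP => x nx; apply: val_inj; apply: funext => X /=.
  rewrite /hw_coind foldl_rcons.
  by rewrite transp_nil.
(* Evaluation at the empty word: right translation by a negative g gives the value at the word g,
   which equivariance turns into [Adual g]. *)
exists (fun x => phi x [::]); split.
- by move=> c x y; rewrite lin.
- by move=> g x ng; rewrite com -coind_neg.
- by rewrite pw.
Qed.

End Coinduced.
End Modules.

(** * Highest weight modules *)

Section HighestWeight.
Variable C : fieldType.
Hypothesis char0 : forall n : int, n%:~R = 0 :> C -> n = 0.

Section OneModule.
Variables (V : lmodType C) (act : Lop -> V -> V).
Hypothesis HL : is_Lmodule act.

Lemma act_lin o : linear (act o). Proof. by case/LmoduleP: HL. Qed.
Lemma act_comm x y v : act x (act y v) - act y (act x v) = brk x y (fun a => act a v).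
Proof. by case/LmoduleP: HL. Qed.
Lemma act_commE x y v : act x (act y v) = brk x y (fun a => act a v) + act y (act x v).
Proof. by rewrite -act_comm subrK. Qed.
Lemma act0 o : act o 0 = 0.
Proof. by have := act_lin o (-1) 0 0; rewrite !scaleN1r oppr0 addr0 addNr. Qed.
Lemma actD o x y : act o (x + y) = act o x + act o y.
Proof. by have := act_lin o 1 x y; rewrite !scale1r. Qed.
Lemma actZ o c x : act o (c *: x) = c *: act o x.
Proof. by have := act_lin o c x 0; rewrite act0 !addr0. Qed.

Lemma submod0 W : Lsubmod act W -> W 0. Proof. by case. Qed.
Lemma submodD W x y : Lsubmod act W -> W x -> W y -> W (x + y).
Proof. by case=> _ _ h _ _; apply: h. Qed.
Lemma submodZ W c x : Lsubmod act W -> W x -> W (c *: x).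
Proof. by case=> _ _ _ h _; apply: h. Qed.
Lemma submod_act W o x : Lsubmod act W -> W x -> W (act o x).
Proof. by case=> _ _ _ _ h; apply: h. Qed.

Inductive nspan (G : V -> Prop) : V -> Prop :=
| nspan_gen x : G x -> nspan G x
| nspan_0 : nspan G 0
| nspan_D x y : nspan G x -> nspan G y -> nspan G (x + y)
| nspan_Z c x : nspan G x -> nspan G (c *: x)
| nspan_act g x : neg g -> nspan G x -> nspan G (act g x).

Lemma brk_closed (P : V -> Prop) x y (t : Lop -> V) :
  P 0 -> (forall u v, P u -> P v -> P (u + v)) -> (forall c u, P u -> P (c *: u)) ->
  (forall a, P (t a)) -> P (brk x y t).
Proof. by move=> P0 PD PZ Pt; rewrite /brk; elim/big_rec: _ => // p u _; apply: PD; apply: PZ. Qed.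

(** In x g v = [x, g] v + g x v every term on the right is covered, by induction on the construction
    of v for all nonnegative x at once. Thus U(L^-) G is already stable under L. *)
Lemma nspan_submod G :
  (forall g x, G g -> ~~ neg x -> nspan G (act x g)) -> Lsubmod act (nspan G).
Proof.
move=> HG; split=> //; [exact: nspan_0 | exact: nspan_D | exact: nspan_Z |].
move=> o x Wx; case no: (neg o); first exact: nspan_act.
move/negbT: no; elim: Wx o => {x} [x Gx||x y _ IHx _ IHy|c x _ IH|g x ng Wx IH] o no.
- exact: HG.
- by rewrite act0; exact: nspan_0.
- by rewrite actD; apply: nspan_D; [apply: IHx|apply: IHy].
- by rewrite actZ; apply: nspan_Z; apply: IH.
rewrite act_commE; apply: nspan_D; last by apply: nspan_act => //; exact: IH.
apply: brk_closed; [exact: nspan_0 | exact: nspan_D | exact: nspan_Z | move=> a].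
by case na: (neg a); [exact: nspan_act | apply: IH; rewrite na].
Qed.

Variable h : C.

Inductive lowspan : V -> Prop :=
| low_gen x (j : nat) : act (OD 0) x = (h - j.+1%:R) *: x -> lowspan x
| low_D x y : lowspan x -> lowspan y -> lowspan (x + y)
| low_Z c x : lowspan x -> lowspan (c *: x).

Lemma act_D0_neg g x c : neg g -> act (OD 0) x = c *: x ->
  exists j : nat, act (OD 0) (act g x) = (c - j.+1%:R) *: act g x.
Proof.
move=> ng ex.
have [j e] : exists j : nat, brk (OD 0) g (fun a => act a x) = (- j.+1%:R) *: act g x.
  { case: g ng => [n|n|||] //= n0; exists (`|n|%N.-1); rewrite /brk /= !big_cons big_nil /=.
  all: have -> : - (`|n|.-1.+1)%:R = n%:~R :> C by rewrite pmulrn -mulrNz; congr (_%:~R); lia.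
  all: rewrite /delta; case: eqP => [|_]; first lia.
  all: by rewrite mul0r scale0r !addr0 ?subr0. }
by exists j; rewrite act_commE e ex actZ scalerBl scaleNr addrC.
Qed.

Lemma low_act g x : neg g -> lowspan x -> lowspan (act g x).
Proof.
move=> ng; elim=> {x} [x j ex|x y _ IHx _ IHy|c x _ IH].
- have [k e] := act_D0_neg ng ex; apply: (@low_gen _ (j + k).+1).
  by rewrite e -addrA -opprD -natrD addSn addnS.
- by rewrite actD; apply: low_D.
- by rewrite actZ; apply: low_Z.
Qed.

(** The operator with factors d_0 - (h - j) for j = 1, ..., K: it kills the weights h - 1, ..., h -
    K and acts on weight h by K!, which separates the top weight from the lower ones. *)
Fixpoint wpoly (K : nat) (x : V) : V :=
  if K is k.+1 then wpoly k (act (OD 0) x - (h - k.+1%:R) *: x) else x.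

Lemma wpoly_linear K : linear (wpoly K).
Proof.
elim: K => [|k IH] c x y //=; rewrite -IH; congr wpoly.
by rewrite act_lin !scalerDr !scalerN !scalerA addrACA [c * _]mulrC opprD.
Qed.

Lemma wpoly_eigen K x c : act (OD 0) x = c *: x ->
  wpoly K x = (\prod_(j < K) (c - (h - j.+1%:R))) *: x.
Proof.
move=> ex; elim: K => [|k IH] /=; first by rewrite big_ord0 scale1r.
rewrite ex -scalerBl big_ord_recr /= [_ * (c - _)]mulrC -scalerA -IH.
have := wpoly_linear k (c - (h - k.+1%:R)) x 0; rewrite addr0 => ->.
have := wpoly_linear k (-1) 0 0; rewrite scaler0 addr0 => e.
by rewrite [X in _ + X]e scaleN1r addNr addr0.
Qed.

Lemma lowspan_wpoly x : lowspan x -> exists K, forall k, (K <= k)%N -> wpoly k x = 0.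
Proof.
elim=> {x} [x j ex|x y _ [K HK] _ [K' HK']|c x _ [K HK]].
- exists j.+1 => k jk; rewrite (wpoly_eigen _ ex) (bigD1 (Ordinal jk)) //=.
  by rewrite subrr mul0r scale0r.
- exists (maxn K K') => k; rewrite geq_max => /andP[Kk K'k].
  by have := wpoly_linear k 1 x y; rewrite !scale1r => ->; rewrite HK ?HK' ?addr0.
- exists K => k Kk; have := wpoly_linear k c x 0.
  have := wpoly_linear k (-1) 0 0; rewrite scaler0 addr0 scaleN1r => e.
  have -> : wpoly k 0 = 0 by rewrite e addNr.
  by rewrite !addr0 => ->; rewrite HK ?scaler0.
Qed.

Lemma lowspan_top x : lowspan x -> act (OD 0) x = h *: x -> x = 0.
Proof.
move=> /lowspan_wpoly[K HK] ex; move: (HK K (leqnn K)); rewrite (wpoly_eigen _ ex) => /eqP.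
rewrite scaler_eq0 => /orP[|/eqP //]; rewrite prodf_seq_eq0 => /hasP[j _] /=.
by rewrite opprB addrCA subrr addr0 => /eqP/(char0 (n := j.+1)).
Qed.

(** A negative operator always lands strictly below the top weight, so only multiples of w remain
    there. *)
Lemma hw_decomp w x : act (OD 0) w = h *: w -> nspan (eq w) x ->
  exists c y, lowspan y /\ x = c *: w + y.
Proof.
move=> ew; have low0 : lowspan 0 by apply: (@low_gen _ 0); rewrite act0 scaler0.
elim=> {x} [x <-||x y _ [c [x' [lx ->]]] _ [c' [y' [ly ->]]]|c x _ [c' [x' [lx ->]]]|g x ng _ [c' [x' [lx ->]]]].
- by exists 1, 0; rewrite scale1r addr0.
- by exists 0, 0; rewrite scale0r addr0.
- by exists (c + c'), (x' + y'); rewrite scalerDl addrACA; split=> //; apply: low_D.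
- by exists (c * c'), (c *: x'); rewrite scalerDr scalerA; split=> //; apply: low_Z.
- have [j e] := act_D0_neg ng ew.
  exists 0, (c' *: act g w + act g x'); rewrite scale0r add0r actD actZ; split=> //.
  by apply: low_D; [apply/low_Z/low_gen/e | apply: low_act].
Qed.

End OneModule.
End HighestWeight.

(** * Simple highest weight modules: uniqueness, local nilpotency, the action of the I_n *)

Section SimpleHighestWeight.
Variable C : fieldType.
Hypothesis char0 : forall n : int, n%:~R = 0 :> C -> n = 0.

Lemma Lsimple_all (V : lmodType C) (act : Lop -> V -> V) W x :
  Lsimple act -> Lsubmod act W -> W x -> x <> 0 -> forall y, W y.
Proof. by case=> _ S HW Wx x0 y; case: (S W HW) => [/(_ x Wx)|/(_ y)]; auto. Qed.

Lemma nspan_hw_submod (V : lmodType C) (act : Lop -> V -> V) w :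
  is_Lmodule act -> (forall x, ~~ neg x -> exists c, act x w = c *: w) ->
  Lsubmod act (nspan act (eq w)).
Proof.
move=> HL H; apply: nspan_submod => // g x <- nx; have [c ->] := H x nx.
by apply: nspan_Z; apply: nspan_gen.
Qed.

Section Product.
Variables (V W : lmodType C) (act : Lop -> V -> V) (actW : Lop -> W -> W).

Definition prod_act o (p : V * W) : V * W := (act o p.1, actW o p.2).

Lemma prod_Lmodule : is_Lmodule act -> is_Lmodule actW -> is_Lmodule prod_act.
Proof.
move=> HV HW; apply/LmoduleP; split=> [o c [x y] [x' y']|x y [v v']].
  by rewrite /prod_act /= (act_lin HV) (act_lin HW).
rewrite /prod_act /=; transitivity (brk x y (fun a => act a v), brk x y (fun a => actW a v')).
  by rewrite -(act_comm HV) -(act_comm HW).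
by rewrite /brk; elim: (bracket C x y) => [|p s]; rewrite ?big_nil // !big_cons => <-.
Qed.
End Product.

(** The submodule of V x W generated by (w, u) is the graph of the isomorphism: its part of weight
    d0 is the line through (w, u), so it contains neither (w, 0) nor (0, u), and simplicity makes
    both projections injective. *)
Lemma simple_hw_uniq (V W : lmodType C) (act : Lop -> V -> V) (actW : Lop -> W -> W)
    (w : V) (u : W) I0 d0 z1 z2 z3 :
  is_simple_hw act w I0 d0 z1 z2 z3 -> is_simple_hw actW u I0 d0 z1 z2 z3 ->
  exists psi : V -> W,
    [/\ linear psi, forall o x, psi (act o x) = actW o (psi x) & bijective psi].
Proof.
case=> HV w0 hwV genV simV [HW u0 hwW genW simW].
have hV := proj1 (hw_vectorP _ _ _ _ _ _ _) hwV; have hW := proj1 (hw_vectorP _ _ _ _ _ _ _) hwW.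
have HP := prod_Lmodule HV HW.
pose R x y := nspan (prod_act act actW) (eq (w, u)) (x, y).
have RS : Lsubmod (prod_act act actW) (nspan (prod_act act actW) (eq (w, u))).
  apply: nspan_hw_submod => // x nx; exists (hw_char I0 d0 z1 z2 z3 x).
  by rewrite /prod_act /= hV ?hW.
have Rwu : R w u by exact: nspan_gen.
have DP : prod_act act actW (OD 0) (w, u) = d0 *: (w, u).
  by rewrite /prod_act /= (hV (OD 0)) // (hW (OD 0)).
have noR c c' : R (c *: w) (c' *: u) -> c = c'.
  move=> /(hw_decomp HP DP)[e [[x y] [lxy [ex ey]]]].
  have {}lxy : lowspan (prod_act act actW) d0 ((c - e) *: w, (c' - e) *: u).
    by rewrite !scalerBl ex ey /= ![_ *: _ + _]addrC !addrK.
  have : ((c - e) *: w, (c' - e) *: u) = 0.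
    apply: (lowspan_top char0 HP lxy); rewrite /prod_act /=.
    rewrite (actZ HV) (actZ HW) (hV (OD 0)) // (hW (OD 0)) //=.
    by congr (_, _); rewrite !scalerA mulrC.
  case=> /eqP; rewrite scaler_eq0 => /orP[|/eqP //]; rewrite subr_eq0 => /eqP->.
  by move=> /eqP; rewrite scaler_eq0 => /orP[|/eqP //]; rewrite subr_eq0 => /eqP->.
have RD x y x' y' : R x y -> R x' y' -> R (x + x') (y + y') by exact: nspan_D.
have RZ c x y : R x y -> R (c *: x) (c *: y) by exact: nspan_Z.
have Ract o x y : R x y -> R (act o x) (actW o y) by move=> /(submod_act o RS).
(* The elements paired with 0 form a submodule of W that misses u. *)
have R0r y : R 0 y -> y = 0.
  have [||full] := proj2 simW (R 0); [|exact|].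
    split=> // [|y1 y2|c y1|o y1]; first exact: nspan_0.
    - by move=> h1 h2; have := RD _ _ _ _ h1 h2; rewrite addr0.
    - by move=> h1; have := RZ c _ _ h1; rewrite scaler0.
    - by move=> h1; have := Ract o _ _ h1; rewrite (act0 HV).
  have := noR 0 1; rewrite scale0r scale1r => /(_ (full u I)) /esym/eqP.
  by rewrite oner_eq0.
have R0l x : R x 0 -> x = 0.
  have [||full] := proj2 simV (R^~ 0); [|exact|].
    split=> // [|y1 y2|c y1|o y1]; first exact: nspan_0.
    - by move=> h1 h2; have := RD _ _ _ _ h1 h2; rewrite addr0.
    - by move=> h1; have := RZ c _ _ h1; rewrite scaler0.
    - by move=> h1; have := Ract o _ _ h1; rewrite (act0 HW).
  have := noR 1 0; rewrite scale0r scale1r => /(_ (full w I)) /eqP.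
  by rewrite oner_eq0.
have RB x y x' y' : R x y -> R x' y' -> R (x - x') (y - y').
  by move=> h1 h2; rewrite -!scaleN1r; apply: RD => //; apply: RZ.
have R00 : R 0 0 by exact: nspan_0.
have [psi Hpsi] : {psi : V -> W & forall x, R x (psi x)}.
  apply: choice; apply: (genV (fun x => exists y, R x y)); last by exists u.
  split=> //.
  - by exists 0.
  - by move=> x y [x' ?] [y' ?]; exists (x' + y'); apply: RD.
  - by move=> c x [x' ?]; exists (c *: x'); apply: RZ.
  - by move=> o x [x' ?]; exists (actW o x'); apply: Ract.
have [phi Hphi] : {phi : W -> V & forall x, R (phi x) x}.
  apply: (@choice W V (fun y x => R x y)); apply: (genW (fun y => exists x, R x y)); last by exists w.
  split=> //.
  - by exists 0.
  - by move=> x y [x' ?] [y' ?]; exists (x' + y'); apply: RD.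
  - by move=> c x [x' ?]; exists (c *: x'); apply: RZ.
  - by move=> o x [x' ?]; exists (act o x'); apply: Ract.
have psiE x y : R x y -> psi x = y.
  by move=> h; apply/eqP; rewrite -subr_eq0; apply/eqP/R0r; rewrite -(subrr x); apply: RB.
exists psi; split.
- by move=> c x y; apply: psiE; apply: RD => //; apply: RZ.
- by move=> o x; apply: psiE; apply: Ract.
exists phi => [x|y]; last exact: psiE.
by apply/eqP; rewrite -subr_eq0; apply/eqP/R0l; rewrite -(subrr (psi x)); apply: RB.
Qed.

Section SimpleModule.
Variables (V : lmodType C) (act : Lop -> V -> V) (w : V) (I0 d0 z1 z2 z3 : C).
Hypothesis Hs : is_simple_hw act w I0 d0 z1 z2 z3.

Let HL : is_Lmodule act. Proof. by case: Hs. Qed.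
Let w0 : w <> 0. Proof. by case: Hs. Qed.
Let hwV x : ~~ neg x -> act x w = hw_char I0 d0 z1 z2 z3 x *: w.
Proof. by case: Hs => _ _ /hw_vectorP h _ _; apply: h. Qed.
Let genV : Lgenerated act w. Proof. by case: Hs. Qed.
Let simV : Lsimple act. Proof. by case: Hs. Qed.

Lemma locally_nilpotent v :
  exists N : nat, forall i : int, i >= N%:Z -> act (OD i) v = 0 /\ act (OI i) v = 0.
Proof.
refine (@genV (fun v => exists N : nat, forall i : int, i >= N%:Z -> act (OD i) v = 0 /\ act (OI i) v = 0) _ _ v) => {v}; last first.
  exists 1%N => i i1; rewrite !hwV /=; try lia.
  have /eqP/negbTE -> : i <> 0 by lia.
  by rewrite !scale0r.
split=> //.
- by exists 0%N => i _; rewrite !(act0 HL).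
- move=> x y [N HN] [N' HN']; exists (maxn N N') => i iN; rewrite !(actD HL).
  have [-> ->] := HN i ltac:(lia); have [-> ->] := HN' i ltac:(lia).
  by rewrite addr0.
- move=> c x [N HN]; exists N => i iN; rewrite !(actZ HL).
  by have [-> ->] := HN i iN; rewrite scaler0.
move=> o x [N HN]; pose k : nat := match o with OD n | OI n => `|n|%N | _ => 0%N end.
(* [k] bounds the degree of [o], so brackets with [o] stay in degrees at least N; the successor also
   excludes i = - n, where a central term could appear. *)
exists (N + k).+1 => i iN.
have [e1 e2] : act (OD i) x = 0 /\ act (OI i) x = 0 by apply: HN; clearbody k; lia.
have Dn n : (`|n| <= k)%N -> act (OD (n + i)) x = 0 /\ act (OI (n + i)) x = 0.
  by move=> nk; apply: HN; clearbody k; lia.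
have Di n : (`|n| <= k)%N -> act (OD (i + n)) x = 0 /\ act (OI (i + n)) x = 0.
  by rewrite addrC; exact: Dn.
have Dd n : (`|n| <= k)%N -> delta i n C = 0 by rewrite /delta; case: eqP => //; clearbody k; lia.
have Dd' n : (`|n| <= k)%N -> delta n i C = 0 by rewrite eq_deltaN; exact: Dd.
split; rewrite (act_commE HL) ?e1 ?e2 (act0 HL) addr0.
all: clear e1 e2; case: o @k iN Dn Di Dd Dd' => [n|n|||] /= iN Dn Di Dd Dd'.
all: rewrite /brk /= ?big_cons big_nil ?addr0 //.
all: have [e1 e2] := Dn n (leqnn _); have [e3 e4] := Di n (leqnn _).
all: rewrite ?Dd ?Dd' // ?e1 ?e2 ?e3 ?e4 ?mul0r ?mulr0 ?oppr0 ?scale0r ?scaler0 ?addr0 //.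
Qed.

Lemma central_act o c : (o = OZ1 \/ o = OZ2 \/ o = OZ3) -> act o w = c *: w ->
  forall v, act o v = c *: v.
Proof.
move=> ho ow; refine (@genV (fun v => act o v = c *: v) _ _) => //; split=> //.
- by rewrite (act0 HL) scaler0.
- by move=> x y ex ey; rewrite (actD HL) ex ey scalerDr.
- by move=> e x ex; rewrite (actZ HL) ex !scalerA mulrC.
- move=> o' x ex; case: HL => _ _ _ _ -> //; by rewrite ex (actZ HL).
Qed.

(** A nonzero v would generate V, but U(L^-) v would then be a submodule with all weights below d0,
    which cannot contain w. *)
Lemma singular_eq0 v (j : nat) :
  act (OD 0) v = (d0 - j.+1%:R) *: v ->
  (forall n : int, 0 < n -> act (OD n) v = 0 /\ act (OI n) v = 0) ->
  (exists c, act (OI 0) v = c *: v) -> v = 0.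
Proof.
move=> dv pv [c iv]; apply: contrapT => v0.
have hv x : ~~ neg x -> exists c, act x v = c *: v.
  case: x => [n|n|||] /= n0.
  - case: (n =P 0) => [->|nz]; first by exists (d0 - j.+1%:R).
    by exists 0; rewrite scale0r; have [] := pv n ltac:(lia).
  - case: (n =P 0) => [->|nz]; first by exists c.
    by exists 0; rewrite scale0r; have [] := pv n ltac:(lia).
  - by exists z1; apply: central_act; [auto | apply: (hwV (x := OZ1))].
  - by exists z2; apply: central_act; [auto | apply: (hwV (x := OZ2))].
  - by exists z3; apply: central_act; [auto | apply: (hwV (x := OZ3))].
have ws : nspan act (eq v) w.
  by apply: (Lsimple_all simV (nspan_hw_submod HL hv) _ v0); exact: nspan_gen.
apply: w0; apply: (lowspan_top char0 HL (h := d0)); last exact: (hwV (x := OD 0)).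
elim: ws => [x <-||x y _ hx _ hy|e x _ hx|g x ng _ hx].
- exact: low_gen dv.
- by apply: (@low_gen _ _ _ _ _ 0); rewrite (act0 HL) scaler0.
- exact: low_D.
- exact: low_Z.
- exact: low_act.
Qed.

(** By induction on k, I_{-k} w is singular of weight d0 - k, since a positive d_n sends it to a
    multiple of I_{n-k} w, already known to be 0; so it vanishes by [singular_eq0]. The vectors
    killed by all I_n then form a submodule containing w. *)
Lemma OI_act0 : I0 = 0 -> z2 = 0 -> z3 = 0 -> forall n v, act (OI n) v = 0.
Proof.
move=> I00 z20 z30.
have Z2 v : act OZ2 v = 0.
  have h : act OZ2 w = z2 *: w by exact: (hwV (x := OZ2)).
  by rewrite (central_act _ h) ?z20 ?scale0r //; auto.
have Z3 v : act OZ3 v = 0.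
  have h : act OZ3 w = z3 *: w by exact: (hwV (x := OZ3)).
  by rewrite (central_act _ h) ?z30 ?scale0r //; auto.
have DI n m v : act (OD n) (act (OI m) v) = m%:~R *: act (OI (m + n)) v + act (OI m) (act (OD n) v).
  by rewrite (act_commE HL) /brk /= !big_cons big_nil /= Z2 scaler0 !addr0.
have II n m v : act (OI n) (act (OI m) v) = act (OI m) (act (OI n) v).
  by rewrite (act_commE HL) /brk /= !big_cons big_nil /= Z3 scaler0 add0r add0r.
have Iw0 n : 0 <= n -> act (OI n) w = 0.
  by move=> n0; rewrite hwV /= -?leNgt //; case: eqP; rewrite ?I00 scale0r.
have Iw k : forall j, (j <= k)%N -> act (OI (- j%:Z)) w = 0.
  elim: k => [|k IH] j; first by rewrite leqn0 => /eqP ->; apply: Iw0.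
  rewrite leq_eqVlt ltnS => /orP[/eqP ->|]; last exact: IH.
  apply: (@singular_eq0 _ k).
  - rewrite DI (hwV (x := OD 0)) //= (actZ HL) addr0 -scalerDl; congr (_ *: _).
    by rewrite mulrNz -pmulrn addrC.
  - move=> n n0; rewrite DI II (hwV (x := OI n)) ?(hwV (x := OD n)) /=; try lia.
    have /eqP/negbTE -> : n <> 0 by lia.
    rewrite !scale0r !(act0 HL) addr0; split=> //.
    have -> : act (OI (- k.+1%:Z + n)) w = 0; last by rewrite scaler0.
    case: (lerP 0 (- k.+1%:Z + n)) => h; first exact: Iw0.
    have -> : - k.+1%:Z + n = - (`|k.+1%:Z - n|%N)%:Z by lia.
    by apply: IH; lia.
  - by exists 0; rewrite II Iw0 // (act0 HL) scale0r.
move=> n v; move: v n; refine (@genV (fun v => forall n, act (OI n) v = 0) _ _); last first.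
  move=> n; case: (lerP 0 n) => h; first exact: Iw0.
  have -> : n = - (`|n|%N)%:Z by lia.
  exact: Iw (leqnn _).
split=> //.
- by move=> n; rewrite (act0 HL).
- by move=> x y hx hy n; rewrite (actD HL) hx hy addr0.
- by move=> c x hx n; rewrite (actZ HL) hx scaler0.
- move=> [m|m|||] x hx n.
  + by have := DI m n x; rewrite !hx (act0 HL) scaler0 add0r.
  + by rewrite II hx (act0 HL).
  + by case: HL => _ _ _ _ h; rewrite -h ?hx ?(act0 HL); auto.
  + by rewrite Z2 (act0 HL).
  + by rewrite Z3 (act0 HL).
Qed.

End SimpleModule.
End SimpleHighestWeight.

(** * Submodules of the tensor product *)

Section Tensor.
Variable C : fieldType.
Hypothesis char0 : forall n : int, n%:~R = 0 :> C -> n = 0.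
Variables (V : lmodType C) (act : Lop -> V -> V) (a b F : C) (excl : int -> bool).
Hypothesis HL : is_Lmodule act.
(* the removed [x^m] span a trivial submodule of [A(a,b;F)] *)
Hypothesis Hexcl : forall m, excl m -> [/\ a + m%:~R = 0, b = 0 & F = 0].

Local Notation op := (tens_op act a b F excl).

(** The tensor v x^m, read as 0 when x^m is removed, so that the action formulas below have no
    exceptions. *)
Definition pure (m : int) (v : V) : int -> V :=
  fun k => if (k == m) && ~~ excl m then v else 0.

Lemma pure_linear m : linear (pure m).
Proof.
move=> c x y; apply: funext => k; rewrite !fctE /pure.
by case: ifP => // _; rewrite scaler0 addr0.
Qed.

HB.instance Definition _ m := GRing.isLinear.Build C V (int -> V) _ (pure m) (pure_linear m).

Lemma pure_excl m v k : excl k -> pure m v k = 0.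
Proof. by move=> xk; rewrite /pure; case: eqP => // <-; rewrite xk. Qed.

Lemma pureE m v k : excl k = false -> pure m v k = if k == m then v else 0.
Proof. by move=> xk; rewrite /pure; case: eqP => // <-; rewrite xk. Qed.

Lemma act_pure o m v k : act o (pure m v k) = pure m (act o v) k.
Proof. by rewrite /pure; case: ifP => // _; rewrite (act0 HL). Qed.

Lemma op_pureD n m v :
  op (OD n) (pure m v) = pure m (act (OD n) v) + (a + m%:~R + n%:~R * b) *: pure (m + n) v.
Proof.
apply: funext => k; rewrite /tens_op -[RHS]/(pure m (act (OD n) v) k + (a + m%:~R + n%:~R * b) *: pure (m + n) v k).
case xk: (excl k); first by rewrite !pure_excl // scaler0 addr0.
rewrite act_pure; congr (_ + _); rewrite [in RHS]pureE //.
rewrite /pure subr_eq; case: eqP => [->|_]; last by rewrite !scaler0.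
rewrite addrK; case xm: (excl m) => //=; have [-> -> _] := Hexcl xm.
by rewrite mulr0 addr0 !scale0r.
Qed.

Lemma op_pureI n m v :
  op (OI n) (pure m v) = pure m (act (OI n) v) + F *: pure (m + n) v.
Proof.
apply: funext => k; rewrite /tens_op -[RHS]/(pure m (act (OI n) v) k + F *: pure (m + n) v k).
case xk: (excl k); first by rewrite !pure_excl // scaler0 addr0.
rewrite act_pure; congr (_ + _); rewrite [in RHS]pureE //.
rewrite /pure subr_eq; case: eqP => _ //.
by case xm: (excl m) => //=; have [_ _ ->] := Hexcl xm; rewrite !scale0r.
Qed.

Lemma op_pureZ o m v : (o = OZ1 \/ o = OZ2 \/ o = OZ3) -> op o (pure m v) = pure m (act o v).
Proof.
move=> ho; apply: funext => k; have -> : op o (pure m v) k = if excl k then 0 else act o (pure m v k).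
  by case: ho => [->|[->|->]].
by case xk: (excl k); rewrite ?act_pure // pure_excl.
Qed.

Definition shift (x : Lop) (f : int -> V) : int -> V := fun m =>
  match x with
  | OD n => (a + (m - n)%:~R + n%:~R * b) *: f (m - n)
  | OI n => F *: f (m - n)
  | _ => 0
  end.

Lemma opE x f m : op x f m = if excl m then 0 else act x (f m) + shift x f m.
Proof. by rewrite /tens_op /shift; case: x => * //; rewrite addr0. Qed.

Lemma shift_comm x y f m :
  shift x (shift y f) m - shift y (shift x f) m = brk x y (fun z => shift z f m).
Proof.
rewrite /brk; case: x y => [n|n|||] [k|k|||]; rewrite /= ?big_cons big_nil ?scaler0 ?subrr ?oppr0 ?addr0 //.
all: have e1 : m - k - n = m - n - k by rewrite addrAC.
all: have e2 : m - (k + n) = m - n - k by rewrite opprD addrA addrAC.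
all: have e3 : m - (n + k) = m - n - k by rewrite opprD addrA.
all: rewrite ?e1 ?scalerA /= ?e2 ?e3 -?scaleNr -?scalerDl.
all: try by (congr (_ *: _); ring).
by rewrite subrr scale0r.
Qed.

Lemma shift_linear x m c f g : shift x (fun k => c *: f k + g k) m = c *: shift x f m + shift x g m.
Proof.
case: x => [n|n|||] /=; rewrite ?scaler0 ?addr0 // scalerDr !scalerA mulrC //.
Qed.

(** [op] resets the values at removed indices to 0; [shift] does not see this, its coefficient at a
    removed source index being 0 by [Hexcl]. *)
Lemma shift_op x y f m : shift x (op y f) m = act y (shift x f m) + shift x (shift y f) m.
Proof.
transitivity (shift x (fun k => 1 *: act y (f k) + shift y f k) m); last first.
  by rewrite shift_linear scale1r; case: x => * /=; rewrite ?(actZ HL) // (act0 HL).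
case: x => [n|n|||] //=; rewrite opE scale1r; case xk: (excl _) => //.
  by have [-> -> _] := Hexcl xk; rewrite mulr0 addr0 !scale0r.
by have [_ _ ->] := Hexcl xk; rewrite !scale0r.
Qed.

(** Taken on all functions [int -> V], which form an [lmodType], so that [nspan_submod] applies to
    the tensor product. *)
Lemma tens_Lmodule : @is_Lmodule C (int -> V) op.
Proof.
apply/LmoduleP; split=> [o c f g|x y f]; apply: funext => m.
  rewrite -[RHS]/(c *: op o f m + op o g m) !opE.
  case: ifP => _; first by rewrite scaler0 addr0.
  by rewrite (act_lin HL) shift_linear scalerDr addrACA.
have -> : (brk x y (fun z => op z f) : int -> V) m = brk x y (fun z => op z f m).
  by rewrite /brk; elim/big_rec2: _ => // p u v _ <-.
rewrite -[LHS]/(op x (op y f) m - op y (op x f) m) !opE.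
case xm: (excl m).
  by rewrite subrr /brk big1 // => p _; rewrite opE xm scaler0.
rewrite !shift_op !(actD HL) (eq_brk x y (fun z => opE z f m)) xm brkD -(act_comm HL) -shift_comm.
by rewrite !opprD !addrA [LHS](ACl (1*5*4*8*(2*7)*(3*6))) /= !subrr !addr0.
Qed.

Local Notation tsub :=
  (is_submod (@tens_space C V excl) (fun _ => 0) (fun f g m => f m + g m)
     (fun c f m => c *: f m) op).

Section Submodule.
Variable W : (int -> V) -> Prop.
Hypothesis HW : tsub W.

Lemma tsubD f g : W f -> W g -> W (f + g). Proof. by case: HW => _ _ h _ _; apply: h. Qed.
Lemma tsubZ c f : W f -> W (c *: f). Proof. by case: HW => _ _ _ h _; apply: h. Qed.
Lemma tsub0 : W 0. Proof. by case: HW. Qed.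
Lemma tsub_op o f : W f -> W (op o f). Proof. by case: HW => _ _ _ _ h; apply: h. Qed.
Lemma tsubB f g : W f -> W g -> W (f - g).
Proof. by move=> hf hg; rewrite -scaleN1r; apply: tsubD => //; apply: tsubZ. Qed.

Lemma tsub_pureD n m v : W (pure m v) -> W (pure (m + n) v) -> W (pure m (act (OD n) v)).
Proof.
move=> h1 h2; rewrite -[pure m _](addrK ((a + m%:~R + n%:~R * b) *: pure (m + n) v)) -op_pureD.
by apply: tsubB; [apply: tsub_op | apply: tsubZ].
Qed.

Lemma tsub_pureI n m v : W (pure m v) -> W (pure (m + n) v) -> W (pure m (act (OI n) v)).
Proof.
move=> h1 h2; rewrite -[pure m _](addrK (F *: pure (m + n) v)) -op_pureI.
by apply: tsubB; [apply: tsub_op | apply: tsubZ].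
Qed.

Lemma tsub_pureZ o m v : (o = OZ1 \/ o = OZ2 \/ o = OZ3) -> W (pure m v) -> W (pure m (act o v)).
Proof. by move=> ho h; rewrite -op_pureZ //; apply: tsub_op. Qed.

Lemma eventually_pure_submod :
  Lsubmod act (fun v => exists M : int, forall m, M <= m -> W (pure m v)).
Proof.
split=> //.
- by exists 0 => m _; rewrite linear0; exact: tsub0.
- move=> x y [M HM] [N HN]; exists (Num.max M N) => m; rewrite ge_max => /andP[h1 h2].
  by rewrite linearD; apply: tsubD; [apply: HM | apply: HN].
- by move=> c x [M HM]; exists M => m h; rewrite linearZ; apply: tsubZ; apply: HM.
- move=> o x [M HM].
  have shiftM n : exists M' : int, forall m, M' <= m -> W (pure m x) /\ W (pure (m + n) x).
    by exists (M + `|n|) => m h; split; apply: HM; lia.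
  case: o => [n|n|||].
  + have [M' H] := shiftM n; exists M' => m /H[]; exact: tsub_pureD.
  + have [M' H] := shiftM n; exists M' => m /H[]; exact: tsub_pureI.
  all: by exists M => m /HM h; apply: tsub_pureZ => //; auto.
Qed.

Lemma all_pure_submod : Lsubmod act (fun v => forall m, W (pure m v)).
Proof.
split=> //.
- by move=> m; rewrite linear0; exact: tsub0.
- by move=> x y h1 h2 m; rewrite linearD; apply: tsubD; [apply: h1|apply: h2].
- by move=> c x h m; rewrite linearZ; apply/tsubZ/h.
- move=> [n|n|||] x h m; [exact: tsub_pureD|exact: tsub_pureI|..]; apply: tsub_pureZ => //; auto.
Qed.

Lemma all_pure_full : (forall v m, W (pure m v)) -> forall f, tens_space excl f -> W f.
Proof.
move=> Wp f [[s]]; elim: s f => [|k s IH] f fs fx.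
  have -> : f = 0 by apply: funext => m; rewrite fs.
  exact: tsub0.
rewrite -(subrK (pure k (f k)) f); apply: tsubD => //; apply: IH => [m ms|m mx].
  rewrite -[LHS]/(f m - pure k (f k) m) /pure.
  case: eqP => [->|/eqP mk] /=; last by rewrite subr0 fs // inE negb_or mk.
  by case: ifP => [_|/negbFE /fx ->]; rewrite ?subrr ?subr0.
by rewrite -[LHS]/(f m - pure k (f k) m) fx // pure_excl // subrr.
Qed.

End Submodule.

End Tensor.

(** * Isolating one component of an element of a submodule *)

Section Isolation.
Variable C : fieldType.
Hypothesis char0 : forall n : int, n%:~R = 0 :> C -> n = 0.
Variables (V : lmodType C) (act : Lop -> V -> V) (a b F : C) (excl : int -> bool).
Hypothesis HL : is_Lmodule act.
Hypothesis Hexcl : forall m, excl m -> [/\ a + m%:~R = 0, b = 0 & F = 0].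
Hypothesis exclP : F = 0 -> b = 0 \/ b = 1 -> forall m, a + m%:~R = 0 -> excl m.
Hypothesis Hnil : forall v, exists N : nat, forall i : int, i >= N%:Z ->
  act (OD i) v = 0 /\ act (OI i) v = 0.

Local Notation op := (tens_op act a b F excl).
Variable W : (int -> V) -> Prop.
Hypothesis HW : is_submod (@tens_space C V excl) (fun _ => 0) (fun f g m => f m + g m)
     (fun c f m => c *: f m) op W.
Variables (f : int -> V) (m0 : int).
Hypothesis Wf : W f.
Hypothesis f0 : f m0 <> 0.

Let f_excl m : excl m -> f m = 0.
Proof. by case: HW => /(_ f Wf)[_ h] _ _ _ _; apply: h. Qed.

Lemma uniform_nil : exists N : nat, forall (i : int) m, i >= N%:Z ->
  act (OD i) (f m) = 0 /\ act (OI i) (f m) = 0.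
Proof.
have [[s fs] _] : tens_space excl f by case: HW => h _ _ _ _; apply: h.
have [N HN] : exists N : nat, forall (i : int) m, m \in s -> i >= N%:Z -> act (OD i) (f m) = 0 /\ act (OI i) (f m) = 0.
  elim: s {fs} => [|k s [N IH]]; first by exists 0%N.
  have [N' HN'] := Hnil (f k); exists (maxn N N') => i m; rewrite inE => /orP[/eqP->|ms] iN.
    by apply: HN'; lia.
  by apply: IH => //; lia.
exists N => i m iN; case ms: (m \in s); first exact: HN.
by rewrite fs ?ms // !(act0 HL).
Qed.

(** The sum of the c(k) f(k) x^(k+s): the shape of f after operators of large degree have been
    applied. *)
Definition scaled (c : int -> C) (s : int) : int -> V :=
  fun m => if excl m then 0 else c (m - s) *: f (m - s).

Local Notation E s c := (W (scaled c s)).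

Lemma scaled_ext s c c' : E s c -> (forall k, c k = c' k) -> E s c'.
Proof. by move=> h e; have <- : c = c' by exact: funext. Qed.

Lemma scaled_lin s x c c' : E s c -> E s c' -> E s (fun k => x * c k + c' k).
Proof.
move=> h1 h2; have := tsubD HW (tsubZ HW x h1) h2; congr W; apply: funext => m.
rewrite -[LHS]/(x *: scaled c s m + scaled c' s m) /scaled.
by case: ifP => _; rewrite ?scaler0 ?addr0 // scalerDl scalerA.
Qed.

Lemma scaledZ s x c : E s c -> E s (fun k => x * c k).
Proof.
move=> h1; have := tsubZ HW x h1; congr W; apply: funext => m.
rewrite -[LHS]/(x *: scaled c s m) /scaled.
by case: ifP => _; rewrite ?scaler0 // scalerA.
Qed.

Lemma scaled0 : E 0 (fun=> 1).
Proof.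
have -> : scaled (fun=> 1) 0 = f; last by [].
apply: funext => m; rewrite /scaled subr0 scale1r; case: ifP => // /f_excl //.
Qed.

Lemma scaled_D N i s c : (forall (i : int) m, i >= N%:Z ->
    act (OD i) (f m) = 0 /\ act (OI i) (f m) = 0) -> N%:Z <= i ->
  E s c -> E (s + i) (fun k => c k * (a + (k + s)%:~R + i%:~R * b)).
Proof.
move=> HN iN /(tsub_op HW (OD i)); congr W; apply: funext => m.
rewrite /tens_op /scaled; case xm: (excl m) => //.
rewrite (actZ HL) (proj1 (HN _ _ iN)) scaler0 add0r opprD addrA addrAC.
rewrite (_ : m - i - s + s = m - i); last by rewrite subrK.
case xi: (excl (m - i)); last by rewrite scalerA mulrC.
by have [-> -> _] := Hexcl xi; rewrite mulr0 addr0 mulr0 !scale0r.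
Qed.

Lemma scaled_I N i s c : (forall (i : int) m, i >= N%:Z ->
    act (OD i) (f m) = 0 /\ act (OI i) (f m) = 0) -> N%:Z <= i ->
  E s c -> E (s + i) (fun k => F * c k).
Proof.
move=> HN iN /(tsub_op HW (OI i)); congr W; apply: funext => m.
rewrite /tens_op /scaled; case xm: (excl m) => //.
rewrite (actZ HL) (proj2 (HN _ _ iN)) scaler0 add0r opprD addrA addrAC.
case xi: (excl (m - i)); last by rewrite scalerA.
by have [_ _ ->] := Hexcl xi; rewrite mul0r !scale0r.
Qed.

Lemma scaled_DD N (j t : int) : (forall (i : int) m, i >= N%:Z ->
    act (OD i) (f m) = 0 /\ act (OI i) (f m) = 0) -> N%:Z <= j -> N%:Z <= t - j ->
  E t (fun k => (a + k%:~R + j%:~R * b) * (a + (k + j)%:~R + (t - j)%:~R * b)).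
Proof.
move=> HN jN tN; have := scaled_D HN tN (scaled_D HN jN scaled0).
rewrite add0r (_ : j + (t - j) = t); last by rewrite addrCA subrr addr0.
by move/scaled_ext; apply => k; rewrite mul1r addr0.
Qed.

(* For F = 0, applying d_{s-j} d_j to [f] multiplies the components by a quadratic
   polynomial in j; [kap] is its second difference in j when b(1 - b) <> 0, and
   its first difference when b = 0 or b = 1. *)
Lemma kernel_family : exists (kap : int -> int -> C) (M : int) (al : int -> C) (N : nat),
  [/\ forall s, M <= s -> E s (kap s),
      forall s, kap s m0 <> 0,
      forall s k, kap (s - N%:Z) k * (a + (k + (s - N%:Z))%:~R + N%:~R * b) = kap s k * (k%:~R + al s) &
      forall (i : int) m, i >= N%:Z -> act (OD i) (f m) = 0 /\ act (OI i) (f m) = 0].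
Proof.
have [N HN] := uniform_nil.
have neq0 n : n <> 0 -> n%:~R <> 0 :> C by move=> n0 /char0.
case: (F =P 0) => [F0|/eqP F0]; last first.
  (* For F <> 0, I_s alone multiplies every component by the constant F. *)
  exists (fun _ _ => 1), N%:Z, (fun s => a + (s - N%:Z)%:~R + N%:~R * b), N; split=> //.
  - move=> s sN; have := scaledZ F^-1 (scaled_I HN sN scaled0); rewrite add0r.
    by move/scaled_ext; apply => k; rewrite mulr1 mulVf.
  - by move=> _; apply/eqP/oner_neq0.
  - by move=> s k; ring.
case: (b =P 0) => [b0|/eqP b0].
  (* The first difference of (a + k)(a + k + j) in j is a + k. It is nonzero at m0, since a + m0 = 0
     would make m0 a removed index. *)
  exists (fun _ k => a + k%:~R), (N%:Z *+ 2 + 1), (fun s => a + (s - N%:Z)%:~R), N; split=> //.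
  - move=> s sN.
    have h1 := scaled_DD (j := N%:Z) (t := s) HN ltac:(lia) ltac:(lia).
    have h2 := scaled_DD (j := N%:Z + 1) (t := s) HN ltac:(lia) ltac:(lia).
    apply: (scaled_ext (scaled_lin (-1) h1 h2)) => k; rewrite b0; ring.
  - by move=> _ /(exclP F0 (or_introl b0))/f_excl.
  - by move=> s k; rewrite b0; ring.
case: (b =P 1) => [b1|/eqP b1].
  (* The first difference of (a + k + j)(a + k + s) in j is a + k + s. If it vanished at m0, [exclP]
     and [Hexcl] would force b = 0. *)
  exists (fun s k => a + (k + s)%:~R), (N%:Z *+ 2 + 1), (fun s => a + (s - N%:Z)%:~R), N; split=> //.
  - move=> s sN.
    have h1 := scaled_DD (j := N%:Z) (t := s) HN ltac:(lia) ltac:(lia).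
    have h2 := scaled_DD (j := N%:Z + 1) (t := s) HN ltac:(lia) ltac:(lia).
    apply: (scaled_ext (scaled_lin (-1) h1 h2)) => k; rewrite b1; ring.
  - move=> s /(exclP F0 (or_intror b1)) /Hexcl[_ /eqP].
    by rewrite (negbTE b0).
  - by move=> s k; rewrite b1; ring.
have b2 : 2 * (b * (1 - b)) != 0.
  rewrite !mulf_neq0 //; last by rewrite subr_eq0 eq_sym.
  by apply/eqP/(neq0 2).
exists (fun _ _ => 1), (N%:Z *+ 2 + 2), (fun s => a + (s - N%:Z)%:~R + N%:~R * b), N; split=> //.
- move=> s sN.
  have h1 := scaled_DD (j := N%:Z) (t := s) HN ltac:(lia) ltac:(lia).
  have h2 := scaled_DD (j := N%:Z + 1) (t := s) HN ltac:(lia) ltac:(lia).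
  have h3 := scaled_DD (j := N%:Z + 2) (t := s) HN ltac:(lia) ltac:(lia).
  apply: (scaled_ext (scaledZ (2 * (b * (1 - b)))^-1 (scaled_lin (-2) h2 (scaled_lin 1 h1 h3)))) => k.
  rewrite -[RHS](mulVf b2); congr (_ * _); ring.
- by move=> _; apply/eqP/oner_neq0.
- by move=> s k; ring.
Qed.

(** By the third clause of [kernel_family], d_N applied at shift s - N gives the coefficients of
    shift s times k + al(s). Subtracting al(s) + j times the latter leaves the factor k - j, and the
    product of these factors over the support kills all components except the one at m0. *)
Lemma isolate : exists v, v <> 0 /\ exists M : int, forall m, M <= m -> W (pure excl m v).
Proof.
have [kap [M [al [N [Ekap kap0 kapE HN]]]]] := kernel_family.
have [[s fs] _] : tens_space excl f by case: HW => h _ _ _ _; apply: h.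
pose p (r : seq int) (k : int) : C := \prod_(j <- r | j != m0) (k - j)%:~R.
have [M' HM'] : exists M' : int, forall t, M' <= t -> E t (fun k => p s k * kap t k).
  elim: s {fs} => [|j s [M' IH]].
    by exists M => t /Ekap; move/scaled_ext; apply => k; rewrite /p big_nil mul1r.
  case: (j =P m0) => [jm|/eqP jm].
    by exists M' => t /IH/scaled_ext; apply => k; rewrite /p big_cons jm eqxx.
  exists (M' + N%:Z) => t tM.
  have h1 := IH t ltac:(lia); have h2 := IH (t - N%:Z) ltac:(lia).
  have h3 := scaled_D HN (lexx _) h2; rewrite subrK in h3.
  apply: (scaled_ext (scaled_lin (- (al t + j%:~R)) h1 h3)) => k.
  rewrite -mulrA -[N%:Z%:~R]/(N%:~R) kapE /p big_cons jm; ring.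
exists (f m0); split=> //; exists (M' + m0) => m mM.
(* The shift m - m0 carries the component at m0 to x^m. *)
have h := HM' (m - m0) ltac:(lia).
have cne : p s m0 * kap (m - m0) m0 != 0.
  apply/eqP => /eqP; rewrite mulf_eq0 => /orP[|/eqP]; last exact: kap0.
  rewrite /p prodf_seq_eq0 => /hasP[j _] /andP[jm /eqP/char0 e].
  by move: jm; rewrite (_ : j = m0) ?eqxx //; lia.
have := tsubZ HW (p s m0 * kap (m - m0) m0)^-1 h; congr W; apply: funext => k.
rewrite -[LHS]/(_ *: scaled _ _ k) /scaled /pure.
case xk: (excl k).
  by rewrite scaler0; case: eqP => // <-; rewrite xk.
case: eqP => [km|km] /=.
  by rewrite -km xk km opprB addrCA subrr addr0 scalerA mulVf // scale1r.
have lm : k - (m - m0) != m0 by apply/eqP; lia.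
case ls: (k - (m - m0) \in s); last by rewrite fs ?ls // !scaler0.
rewrite [X in _ *: X](_ : _ = 0) ?scaler0 // /p (big_rem _ ls) lm /=.
by rewrite subrr !mul0r scale0r.
Qed.
End Isolation.

(** * The functions rho *)

Definition gen_op (g : gen) : Lop :=
  match g with GD k => OD (- k.+1%:Z) | GI k => OI (- k.+1%:Z) end.

Lemma neg_gen_op g : neg (gen_op g). Proof. by case: g => k /=; lia. Qed.

Lemma gactE (C : fieldType) (V : lmodType C) (act : Lop -> V -> V) g :
  gact act g = act (gen_op g).
Proof. by case: g. Qed.

Section Words.
Variables (C : fieldType) (V : lmodType C) (act : Lop -> V -> V).

Lemma Uact_cons p Q x : Uact act (p :: Q) x = p.1 *: wact act p.2 x + Uact act Q x.
Proof. by rewrite /Uact big_cons. Qed.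

Lemma Uact_morph (V' : lmodType C) (act' : Lop -> V' -> V') (phi : V -> V') Q x :
  linear phi -> (forall o x, phi (act o x) = act' o (phi x)) ->
  phi (Uact act Q x) = Uact act' Q (phi x).
Proof.
move=> lin com; have phi0 : phi 0 = 0.
  by have := lin (-1) 0 0; rewrite scaler0 addr0 scaleN1r addNr.
elim: Q => [|p Q IH]; first by rewrite /Uact !big_nil.
rewrite Uact_cons lin IH [in RHS]/Uact big_cons; congr (_ *: _ + _).
by elim: p.2 => [|g u IHu] //=; rewrite !gactE com IHu.
Qed.
End Words.

(** * Simplicity from nonvanishing of rho *)

Section Criterion.
Variable C : fieldType.
Hypothesis char0 : forall n : int, n%:~R = 0 :> C -> n = 0.
Variables (V : lmodType C) (act : Lop -> V -> V) (w : V) (I0 d0 z1 z2 z3 : C).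
Hypothesis Hs : is_simple_hw act w I0 d0 z1 z2 z3.
Variables (a b F : C) (excl : int -> bool).
Hypothesis Hexcl : forall m, excl m -> [/\ a + m%:~R = 0, b = 0 & F = 0].
Hypothesis exclP : F = 0 -> b = 0 \/ b = 1 -> forall m, a + m%:~R = 0 -> excl m.

Let HL : is_Lmodule act. Proof. by case: Hs. Qed.
Let w0 : w <> 0. Proof. by case: Hs. Qed.
Let hwV x : ~~ neg x -> act x w = hw_char I0 d0 z1 z2 z3 x *: w.
Proof. by case: Hs => _ _ /hw_vectorP h _ _; apply: h. Qed.
Let genV : Lgenerated act w. Proof. by case: Hs. Qed.
Let simV : Lsimple act. Proof. by case: Hs. Qed.

Local Notation op := (tens_op act a b F excl).
Local Notation tsub :=
  (is_submod (@tens_space C V excl) (fun _ => 0) (fun f g m => f m + g m)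
     (fun c f m => c *: f m) op).

Lemma nexcl_above n : exists m, n < m /\ ~ excl m.
Proof.
case x1: (excl (n + 1)); last by exists (n + 1); rewrite x1; split=> //; lia.
exists (n + 2); split; first lia.
have [e1 _ _] := Hexcl x1; case/Hexcl => e2 _ _.
suff : (1 : int) = 0 by [].
apply: char0; rewrite -(subrr 0) -{1}e2 -e1; ring.
Qed.

Lemma pure_tens m v : @tens_space C V excl (pure excl m v).
Proof.
split=> [|k xk]; last exact: pure_excl.
by exists [:: m] => k; rewrite inE /pure => /negbTE ->.
Qed.

Lemma pure_neq0 m : ~ excl m -> pure excl m w <> 0.
Proof. by move=> /negP xm /(congr1 (@^~ m)); rewrite /pure eqxx xm. Qed.

Lemma tens_simple_criterion :
  (forall W, tsub W -> (exists M : int, forall m, M <= m -> W (pure excl m w)) ->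
     forall m, W (pure excl m w)) ->
  tens_simple act a b F excl.
Proof.
move=> H; split.
  have [m [_ xm]] := nexcl_above 0; exists (pure excl m w).
  by split; [exact: pure_tens | exact: pure_neq0].
move=> W HW; case: (pselect (forall f, W f -> f = fun=> 0)) => [|nz]; [by left | right].
have [f [Wf f0]] : exists f, W f /\ f <> fun=> 0.
  by apply: contrapT => h; apply: nz => f Wf; apply: contrapT => f0; apply: h; exists f.
have [m0 fm0] : exists m, f m <> 0.
  apply: contrapT => h; apply: f0; apply: funext => m.
  by apply: contrapT => fm; apply: h; exists m.
have [v [v0 ev]] := isolate char0 HL Hexcl exclP (locally_nilpotent Hs) HW Wf fm0.
have := Lsimple_all simV (eventually_pure_submod HL Hexcl HW) ev v0 => /(_ w) /(H W HW) allw.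
apply: (all_pure_full HW) => v' m.
by apply: (genV (all_pure_submod HL Hexcl HW) allw).
Qed.

(** The first claim feeds the second: (u w) x^m is in W for m = n + deg u + i, and applying d_{-i}
    or I_{-i} to it makes the new word at x^m, modulo W, minus a scalar times (u w) x^(m-i). This is
    the recursion for rho_n. *)
Lemma pure_wact W (n : int) : tsub W -> (forall m, n < m -> W (pure excl m w)) ->
  forall u, (forall m, n + (wdeg u)%:Z < m -> W (pure excl m (wact act u w))) /\
    W (pure excl (n + (wdeg u)%:Z) (wact act u w) - rho_word a b F n u *: pure excl n w).
Proof.
move=> HW Hn; elim=> [|g u [IH1 IH2]].
  rewrite /wdeg big_nil addr0 /= scale1r subrr; split=> //.
  exact: tsub0 HW.
have dg : wdeg (g :: u) = (gen_deg g + wdeg u)%N by rewrite /wdeg big_cons.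
rewrite dg /= gactE; case: g dg => k _ /=.
- split=> [m mn|].
    by apply: (tsub_pureD HL Hexcl HW); apply: IH1; lia.
  have h1 : W (pure excl (n + (k.+1 + wdeg u)%N) (wact act u w)) by apply: IH1; lia.
  have e : n + (k.+1 + wdeg u)%N%:Z + - k.+1%:Z = n + (wdeg u)%:Z by lia.
  have := op_pureD HL Hexcl (- k.+1%:Z) (n + (k.+1 + wdeg u)%N) (wact act u w).
  rewrite e => /eqP; rewrite -subr_eq => /eqP <-.
  (* The coefficient a + m + i b at m = n + deg u + k + 1 and i = - (k + 1); up to sign it is the
     factor in [rho_word]. *)
  set c := a + _ + _.
  have -> : a + (wdeg u)%:R + (k.+1)%:R + n%:~R - (k.+1)%:R * b = c.
    by rewrite /c PoszD; ring.
  rewrite mulNr scaleNr opprK -addrA [- _ + _]addrC -scalerA -scalerBr.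
  apply: (tsubD HW); first exact: (tsub_op HW).
  rewrite -opprB scalerN -scaleNr; exact: (tsubZ HW).
- split=> [m mn|].
    by apply: (tsub_pureI HL Hexcl HW); apply: IH1; lia.
  have h1 : W (pure excl (n + (k.+1 + wdeg u)%N) (wact act u w)) by apply: IH1; lia.
  have e : n + (k.+1 + wdeg u)%N%:Z + - k.+1%:Z = n + (wdeg u)%:Z by lia.
  have := op_pureI HL Hexcl (- k.+1%:Z) (n + (k.+1 + wdeg u)%N) (wact act u w).
  rewrite e => /eqP; rewrite -subr_eq => /eqP <-.
  rewrite mulNr scaleNr opprK -addrA [- _ + _]addrC -scalerA -scalerBr.
  apply: (tsubD HW); first exact: (tsub_op HW).
  rewrite -opprB scalerN -scaleNr; exact: (tsubZ HW).
Qed.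

Lemma pure_Uact W (n : int) Q : tsub W -> (forall m, n < m -> W (pure excl m w)) ->
  Uhomog Q -> Uact act Q w = 0 -> rho a b F n Q <> 0 -> W (pure excl n w).
Proof.
move=> HW Hn [k hQ] Qw r0.
suff H : W (pure excl (n + k%:Z) (Uact act Q w) - rho a b F n Q *: pure excl n w).
  move: H; rewrite Qw linear0 sub0r -scaleNr => /(tsubZ HW (- rho a b F n Q)^-1).
  by rewrite scalerA mulVf ?scale1r // oppr_eq0; apply/eqP.
elim: Q hQ {Qw r0} => [_|p Q IH /andP[/eqP dp /IH h]].
  by rewrite /Uact /rho !big_nil linear0 scale0r subrr; exact: tsub0 HW.
rewrite Uact_cons /rho big_cons linearD linearZ scalerDl opprD addrACA.
apply: (tsubD HW) => //; rewrite -scalerA -scalerBr -dp; apply: (tsubZ HW).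
by have [] := pure_wact HW Hn p.2.
Qed.

Lemma tens_simple_if Q1 Q2 : Uhomog Q1 -> Uhomog Q2 ->
  Uact act Q1 w = 0 -> Uact act Q2 w = 0 ->
  (forall n, ~ excl n -> (rho a b F n Q1, rho a b F n Q2) <> (0, 0)) ->
  tens_simple act a b F excl.
Proof.
move=> hQ1 hQ2 Qw1 Qw2 Hr; apply: tens_simple_criterion => W HW [M HM].
have H k : forall m, M - k%:Z <= m -> W (pure excl m w).
  elim: k => [|k IH] m; first by rewrite subr0; exact: HM.
  move=> mk; case: (ltrP m (M - k%:Z)) => [mM|]; last exact: IH.
  have Hm m' : m < m' -> W (pure excl m' w) by move=> h; apply: IH; lia.
  case: (pselect (excl m)) => [xm|xm].
    have -> : pure excl m w = 0 by apply: funext => j; rewrite /pure xm andbF.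
    exact: tsub0 HW.
  case: (rho a b F m Q1 =P 0) => [r1|/(pure_Uact HW Hm hQ1 Qw1)//].
  case: (rho a b F m Q2 =P 0) => [r2|/(pure_Uact HW Hm hQ2 Qw2)//].
  by case: (Hr m xm); rewrite r1 r2.
by move=> m; apply: (H `|M - m|%N); lia.
Qed.

End Criterion.

(** * Invariant functionals *)

Section VermaQuotient.
Variable C : fieldType.
Variables (V : lmodType C) (act : Lop -> V -> V) (w : V) (I0 d0 z1 z2 z3 : C).
Hypothesis Hs : is_simple_hw act w I0 d0 z1 z2 z3.
Variables (M : lmodType C) (actM : Lop -> M -> M) (wM : M).
Hypothesis HM : is_verma actM wM I0 d0 z1 z2 z3.
Variables Q1 Q2 : Usum C.
Hypothesis Hmax : maxsub_gen actM wM Q1 Q2.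

Let S (x : M) := exists p1 p2 : Usum C,
  x = Uact actM p1 (Uact actM Q1 wM) + Uact actM p2 (Uact actM Q2 wM).

(** The kernel lies in S by maximality. Conversely, the image of S in V is 0 or V; in the second
    case wM differs from an element of S by an element of the kernel, so S would contain the
    generator wM and be everything. *)
Lemma verma_quotient : exists pi : M -> V,
  [/\ linear pi, forall o x, pi (actM o x) = act o (pi x), pi wM = w,
      forall v, exists x, pi x = v & forall x, pi x = 0 <-> S x].
Proof.
case: Hs => HV w0 hwV genV simV; case: HM => _ _ genM univ.
have [pi [lin com pw]] := univ V act w HV hwV.
case: Hmax => SS [x0 Sx0] Smax.
have pi0 : pi 0 = 0 by have := lin (-1) 0 0; rewrite scaler0 addr0 scaleN1r addNr.
have piD x y : pi (x + y) = pi x + pi y by have := lin 1 x y; rewrite !scale1r.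
have piZ c x : pi (c *: x) = c *: pi x by have := lin c x 0; rewrite pi0 !addr0.
have kerS x : pi x = 0 -> S x.
  apply: (Smax (fun x => pi x = 0)); last by exists wM; rewrite pw.
  split=> // [y z hy hz|c y hy|o y hy].
  - by rewrite piD hy hz addr0.
  - by rewrite piZ hy scaler0.
  - by rewrite com hy (act0 HV).
exists pi; split=> // [v|x].
  apply: (genV (fun v => exists x, pi x = v)); last by exists wM.
  split=> //; first by exists 0.
  - by move=> _ _ [x <-] [y <-]; exists (x + y).
  - by move=> c _ [x <-]; exists (c *: x).
  - by move=> o _ [x <-]; exists (actM o x).
split; first exact: kerS.
have imS : Lsubmod act (fun v => exists2 x, S x & pi x = v).
  split=> //.
  - by exists 0 => //; exact: (submod0 SS).
  - by move=> _ _ [y Sy <-] [z Sz <-]; exists (y + z) => //; exact: (submodD SS).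
  - by move=> c _ [y Sy <-]; exists (c *: y) => //; exact: (submodZ c SS).
  - by move=> o _ [y Sy <-]; exists (actM o y) => //; exact: (submod_act o SS).
case: (proj2 simV _ imS) => [im0 Sx|/(_ w I) [y Sy pyw]]; first by apply: im0; exists x.
case: Sx0; apply: (genM _ SS).
have /kerS Sd : pi (wM - y) = 0 by rewrite -scaleN1r piD piZ pyw pw scaleN1r subrr.
by have := submodD SS Sd Sy; rewrite subrK.
Qed.

Lemma Uact_max : Uact act Q1 w = 0 /\ Uact act Q2 w = 0.
Proof.
have [pi [lin com <- _ ker]] := verma_quotient.
have one Q : Uact actM [:: (1, [::])] Q = Q by rewrite /Uact big_seq1 scale1r.
have nul Q : Uact actM [::] Q = 0 by rewrite /Uact big_nil.
rewrite -!(Uact_morph _ _ lin com); split; apply/ker.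
- by exists [:: (1, [::])], [::]; rewrite one nul addr0.
- by exists [::], [:: (1, [::])]; rewrite one nul add0r.
Qed.

Variables (a b F : C).

Section Functional.
Variable n : int.

(** Each letter moves the support from n towards n + deg u, and [Adual] contributes the
    corresponding factor of [rho_word]. *)
Lemma dual_wact (phi : M -> int -> C^o) :
  (forall g x, neg g -> phi (actM g x) = Adual a b F g (phi x)) ->
  phi wM = delta_fun C n ->
  forall u, phi (wact actM u wM) =
    fun m => rho_word a b F n u * (m == n + (wdeg u)%:Z)%:R.
Proof.
move=> com pw; elim=> [|g u IH] /=.
  by rewrite pw; apply: funext => m; rewrite mul1r /wdeg big_nil addr0.
have dg : wdeg (g :: u) = (gen_deg g + wdeg u)%N by rewrite /wdeg big_cons.
rewrite dg gactE com ?neg_gen_op // IH; apply: funext => m.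
have e (k : nat) : (m - k.+1%:Z == n + (wdeg u)%:Z) = (m == n + (k.+1 + wdeg u)%N%:Z) by apply/eqP/eqP; lia.
case: g {dg} => k /=; rewrite e; case: eqP => [em|_] /=; rewrite ?mulr0 //.
  by rewrite !mulr1 em PoszD; congr (_ * _); ring.
by rewrite !mulr1.
Qed.

Lemma dual_Uact (phi : M -> int -> C^o) Q :
  linear phi -> (forall g x, neg g -> phi (actM g x) = Adual a b F g (phi x)) ->
  phi wM = delta_fun C n -> Uhomog Q -> rho a b F n Q = 0 -> phi (Uact actM Q wM) = 0.
Proof.
move=> lin com pw [k hQ] rQ; have phi0 : phi 0 = 0.
  by have := lin (-1) 0 0; rewrite scaler0 addr0 scaleN1r addNr.
have -> : phi (Uact actM Q wM) = fun m => rho a b F n Q * (m == n + k%:Z)%:R; last first.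
  by apply: funext => m; rewrite rQ mul0r.
elim: Q hQ {rQ} => [_|p Q IH /andP[/eqP dp /IH {}IH]].
  by rewrite /Uact /rho !big_nil phi0; apply: funext => m; rewrite mul0r.
rewrite Uact_cons lin IH (dual_wact com pw); apply: funext => m.
rewrite /rho big_cons mulrDl -mulrA dp.
by [].
Qed.

(** The kernel of the map given by [verma_dual] is stable under L^- and contains both generators,
    hence the whole maximal submodule; so the map factors through V. *)
Lemma simple_dual : Uhomog Q1 -> Uhomog Q2 ->
  rho a b F n Q1 = 0 -> rho a b F n Q2 = 0 ->
  exists phi : V -> int -> C^o,
    [/\ linear phi, forall g x, neg g -> phi (act g x) = Adual a b F g (phi x) &
        phi w = delta_fun C n].
Proof.
move=> hQ1 hQ2 r1 r2.
have [phi [lin com pw]] := verma_dual a b F n HM.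
have [pi [plin pcom piw surj ker]] := verma_quotient.
have phi0 : phi 0 = 0 by have := lin (-1) 0 0; rewrite scaler0 addr0 scaleN1r addNr.
have phiD x y : phi (x + y) = phi x + phi y by have := lin 1 x y; rewrite !scale1r.
have phi_w u x : phi x = 0 -> phi (wact actM u x) = 0.
  move=> x0; elim: u => [|g u IH] //=.
  by rewrite gactE com ?neg_gen_op // IH linear0.
have phi_U Q x : phi x = 0 -> phi (Uact actM Q x) = 0.
  move=> x0; elim: Q => [|p Q IH]; first by rewrite /Uact big_nil.
  by rewrite Uact_cons lin IH phi_w // scaler0 addr0.
have phiS x : pi x = 0 -> phi x = 0.
  move=> /ker[p1 [p2 ->]]; rewrite phiD (phi_U _ _ (dual_Uact lin com pw hQ1 r1)).
  by rewrite (phi_U _ _ (dual_Uact lin com pw hQ2 r2)) addr0.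
have [s Hs'] := choice surj.
have phiE x y : pi x = pi y -> phi x = phi y.
  move=> e; have : pi (-1 *: y + x) = 0 by rewrite plin e scaleN1r addNr.
  by move/phiS; rewrite lin scaleN1r addrC => /eqP; rewrite subr_eq0 => /eqP.
exists (fun v => phi (s v)); split.
- by move=> c x y; rewrite -lin; apply: phiE; rewrite plin !Hs'.
- by move=> g x ng; rewrite -com //; apply: phiE; rewrite pcom !Hs'.
- by rewrite -pw; apply: phiE; rewrite Hs' piw.
Qed.

End Functional.
End VermaQuotient.

Section Sums.
Variable (R : nzRingType).

(** Gives meaning to sums over Z of finitely supported functions: the choice of a duplicate-free
    list covering the support does not matter. *)
Lemma sum_cover (h : int -> R) (s0 s : seq int) :
  uniq s -> {subset s0 <= s} -> (forall m, m \notin s0 -> h m = 0) ->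
  \sum_(m <- s) h m = \sum_(m <- undup s0) h m.
Proof.
move=> us sub h0; rewrite (bigID (mem s0)) /= [X in _ + X]big1 ?addr0; last by move=> m /h0.
rewrite -big_filter; apply: perm_big; apply: uniq_perm; rewrite ?filter_uniq ?undup_uniq //.
by move=> m; rewrite mem_filter mem_undup; case ms: (m \in s0) => //; rewrite sub.
Qed.

Lemma sum_shift (h : int -> R) (i : int) (s0 s : seq int) :
  uniq s -> {subset s0 <= s} -> {subset [seq m + i | m <- s0] <= s} ->
  (forall m, m \notin s0 -> h m = 0) ->
  \sum_(m <- s) h (m - i) = \sum_(m <- s) h m.
Proof.
move=> us sub subi h0; rewrite [RHS](sum_cover us sub h0).
rewrite -(big_map (fun m => m - i) xpredT h); apply: sum_cover => //.
  by rewrite map_inj_uniq //; apply: addIr.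
move=> m ms; apply/mapP; exists (m + i); last by rewrite addrK.
by apply: subi; apply: map_f.
Qed.
End Sums.

(** * Failure of simplicity when rho_n kills both generators *)

Section OnlyIf.
Variable C : fieldType.
Hypothesis char0 : forall n : int, n%:~R = 0 :> C -> n = 0.
Variables (V : lmodType C) (act : Lop -> V -> V) (w : V) (I0 d0 z1 z2 z3 : C).
Hypothesis Hs : is_simple_hw act w I0 d0 z1 z2 z3.
Variables (a b F : C) (excl : int -> bool).
Hypothesis Hexcl : forall m, excl m -> [/\ a + m%:~R = 0, b = 0 & F = 0].

Let HL : is_Lmodule act. Proof. by case: Hs. Qed.
Let w0 : w <> 0. Proof. by case: Hs. Qed.
Let hwV x : ~~ neg x -> act x w = hw_char I0 d0 z1 z2 z3 x *: w.
Proof. by case: Hs => _ _ /hw_vectorP h _ _; apply: h. Qed.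
Let genV : Lgenerated act w. Proof. by case: Hs. Qed.

Local Notation op := (tens_op act a b F excl).

Lemma tens_op_space o f : @tens_space C V excl f -> @tens_space C V excl (op o f).
Proof.
case=> [[s fs] fx]; split=> [|m xm]; last by rewrite opE xm.
pose i : int := match o with OD i | OI i => i | _ => 0 end.
exists (s ++ [seq m + i | m <- s]) => m; rewrite mem_cat negb_or => /andP[ms mi].
rewrite opE fs // (act0 HL) add0r.
have mis : m - i \notin s.
  by apply: contra mi => h; apply/mapP; exists (m - i); rewrite ?subrK.
by case: (excl m) => //; case: o @i mi mis => [j|j|||] //= _ h; rewrite fs ?scaler0.
Qed.

Variables (n : int) (phi : V -> int -> C^o).
Hypothesis phi_lin : linear phi.
Hypothesis phi_com : forall g x, neg g -> phi (act g x) = Adual a b F g (phi x).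
Hypothesis phi_w : phi w = delta_fun C n.
Hypothesis n_nexcl : ~ excl n.

Let phi0 : phi 0 = 0.
Proof. by have := phi_lin (-1) 0 0; rewrite scaler0 addr0 scaleN1r addNr. Qed.

(** At a removed index every coefficient of [Adual] vanishes, and [phi w] is supported at n, which
    is not removed; so [phi] takes values in functionals that are zero on the removed part. *)
Lemma phi_excl v m : excl m -> phi v m = 0.
Proof.
move=> xm; have [am b0 F0] := Hexcl xm.
have : nspan act (eq w) v.
  apply: (genV (nspan_hw_submod HL _)); last exact: nspan_gen.
  by move=> x nx; exists (hw_char I0 d0 z1 z2 z3 x); exact: hwV.
elim=> {v} [v <-||x y _ hx _ hy|c x _ hx|g x ng _ hx].
- by rewrite phi_w /delta_fun; case: eqP => // e; case: n_nexcl; rewrite -e.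
- by rewrite phi0.
- by have := phi_lin 1 x y; rewrite !scale1r => ->; rewrite -[LHS]/(phi x m + phi y m) hx hy addr0.
- by have := phi_lin c x 0; rewrite phi0 !addr0 => ->; rewrite -[LHS]/(c *: phi x m) hx scaler0.
- rewrite phi_com //; case: g ng => [i|i|||] //= _.
    by rewrite /Adual am b0 mulr0 addr0 oppr0 mul0r.
  by rewrite /Adual F0 oppr0 mul0r.
Qed.

(* [f |-> \sum_m phi (f m) m] is an L^- -invariant functional. *)
Definition pairing_null (f : int -> V) := exists s0 : seq int, forall s, uniq s ->
  {subset s0 <= s} -> \sum_(m <- s) phi (f m) m = 0 :> C.

Lemma pairing_null_op g f : neg g -> @tens_space C V excl f -> pairing_null (op g f).
Proof.
move=> ng [[s0 fs] fx].
pose i : int := match g with OD i | OI i => i | _ => 0 end.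
pose c m : C := match g with OD i => a + m%:~R + i%:~R * b | _ => F end.
exists (s0 ++ [seq m + i | m <- s0]) => s us sub.
have sub1 : {subset s0 <= s} by move=> m ms; apply: sub; rewrite mem_cat ms.
have sub2 : {subset [seq m + i | m <- s0] <= s} by move=> m ms; apply: sub; rewrite mem_cat ms orbT.
(* The action on V contributes - h(m) and the action on the powers of x contributes h(m - i), so the
   sum cancels after reindexing. *)
pose h m : C := c m * phi (f m) (m + i).
have h0 m : m \notin s0 -> h m = 0.
  by move=> ms; rewrite /h fs // phi0 [X in _ * X](_ : _ = 0) ?mulr0.
have step m : phi (op g f m) m = h (m - i) - h m.
  rewrite opE; case xm: (excl m).
    rewrite phi0 /h (fx m) // phi0 subrK phi_excl // mulr0.
    by rewrite [X in _ * X](_ : _ = 0) // mulr0 subr0.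
  have := phi_lin 1 (act g (f m)) (shift a b F g f m); rewrite !scale1r => ->.
  rewrite -[LHS]/(phi (act g (f m)) m + phi (shift a b F g f m) m) phi_com // addrC /h /c /i /shift /Adual.
  have phiZ e x : phi (e *: x) m = e * phi x m.
    by have := phi_lin e x 0; rewrite phi0 !addr0 => ->.
  by case: g ng @i @c sub sub2 @h h0 => [j|j|||] //= *; rewrite phiZ subrK mulNr.
under eq_bigr do rewrite step.
by rewrite sumrB (sum_shift us sub1 sub2 h0) subrr.
Qed.

Lemma tens_not_simple : ~ tens_simple act a b F excl.
Proof.
case=> _ simT.
have HLT := tens_Lmodule HL Hexcl.
pose G (f : int -> V) := exists2 j, n < j & f = pure excl j w.
(* Nonnegative operators act on w by scalars and never lower the index, so they preserve the span of
   the w x^j with j > n. *)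
have YS : Lsubmod op (nspan (op : Lop -> (int -> V) -> (int -> V)) G).
  apply: nspan_submod => // f x [j nj ->] nx.
  have gen k : n < k -> nspan (op : Lop -> (int -> V) -> (int -> V)) G (pure excl k w).
    by move=> nk; apply: nspan_gen; exists k.
  have hw y : ~~ neg y -> nspan (op : Lop -> (int -> V) -> (int -> V)) G (pure excl j (act y w)).
    by move=> ny; rewrite hwV // linearZ; apply: nspan_Z; exact: gen.
  { case: x nx => [i|i|||] nx.
  - rewrite (op_pureD HL Hexcl); apply: nspan_D; first exact: hw.
    by apply: nspan_Z; apply: gen; move: nx => /=; lia.
  - rewrite (op_pureI HL Hexcl); apply: nspan_D; first exact: hw.
    by apply: nspan_Z; apply: gen; move: nx => /=; lia.
  all: by rewrite (op_pureZ _ _ _ _ HL); auto; apply: hw. }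
pose Y := nspan (op : Lop -> (int -> V) -> (int -> V)) G.
have Ytens f : Y f -> @tens_space C V excl f.
  elim=> {f} [_ [j _ ->]||f g _ [[s hs] hx] _ [[s' hs'] hx']|c f _ [[s hs] hx]|g f _ _].
  - exact: pure_tens.
  - by split=> //; exists [::].
  - split=> [|m xm]; last by rewrite -[LHS]/(f m + g m) hx // hx' // addr0.
    exists (s ++ s') => m; rewrite mem_cat negb_or => /andP[/hs h1 /hs' h2].
    by rewrite -[LHS]/(f m + g m) h1 h2 addr0.
  - split=> [|m xm]; last by rewrite -[LHS]/(c *: f m) hx // scaler0.
    by exists s => m /hs h1; rewrite -[LHS]/(c *: f m) h1 scaler0.
  - exact: tens_op_space.
have YT : is_submod (@tens_space C V excl) (fun _ => 0) (fun f g m => f m + g m)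
     (fun c f m => c *: f m) op Y.
  by case: YS => _ h1 h2 h3 h4; split.
have Ynull f : Y f -> pairing_null f.
  elim=> {f} [_ [j nj ->]||f g _ [s hs] _ [s' hs']|c f _ [s hs]|g f ng Yf _].
  - exists [::] => s us _; apply: big1_seq => m _; rewrite /pure.
    case: ifP => [/andP[/eqP-> _]|_]; last by rewrite phi0.
    by rewrite phi_w /delta_fun; case: eqP => // e; move: nj; rewrite e ltxx.
  - by exists [::] => s us _; apply: big1_seq => m _; rewrite phi0.
  - exists (s ++ s') => t ut sub.
    have h1 : {subset s <= t} by move=> m ms; apply: sub; rewrite mem_cat ms.
    have h2 : {subset s' <= t} by move=> m ms; apply: sub; rewrite mem_cat ms orbT.
    transitivity (\sum_(m <- t) (phi (f m) m : C) + \sum_(m <- t) phi (g m) m).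
      rewrite -big_split; apply: eq_bigr => m _; have := phi_lin 1 (f m) (g m).
      by rewrite !scale1r => ->.
    by rewrite hs ?hs' ?addr0.
  - exists s => t ut sub; transitivity (c * \sum_(m <- t) (phi (f m) m : C)); last by rewrite hs ?mulr0.
    by rewrite mulr_sumr; apply: eq_bigr => m _; have := phi_lin c (f m) 0; rewrite phi0 !addr0 => ->.
  - by apply: pairing_null_op => //; exact: Ytens.
case: (simT Y YT) => [Y0|Yall].
  have [j [nj xj]] := nexcl_above char0 Hexcl n.
  by apply: (pure_neq0 Hs xj); apply: Y0; apply: nspan_gen; exists j.
(* [Y] is not the whole space: w x^n pairs to 1. *)
have /Ynull[s0 hs] := Yall _ (pure_tens excl n w).
have sub : {subset s0 <= undup (n :: s0)} by move=> m ms; rewrite mem_undup inE ms orbT.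
have := hs _ (undup_uniq _) sub; rewrite (bigD1_seq n) ?undup_uniq ?mem_undup ?mem_head //.
rewrite big1 => [|m /negbTE mn]; last by rewrite /pure mn /= phi0.
rewrite /pure eqxx (introF idP n_nexcl) /= phi_w /delta_fun eqxx addr0 => /eqP.
by rewrite oner_eq0.
Qed.

End OnlyIf.

(** * Virasoro modules and the theorem *)

Section Virasoro.
Variables (C : fieldType) (W : lmodType C) (actW : Virop -> W -> W).

(** Extension by zero from Vir to L, under which V(d0, z1) becomes a realization of V(0, d0, z1, 0,
    0). *)
Definition vir_act (o : Lop) : W -> W :=
  match o with OD n => actW (VD n) | OZ1 => actW VZ1 | _ => fun=> 0 end.

Lemma vir_Lmodule : is_Virmodule actW -> is_Lmodule vir_act.
Proof.
case=> lin DD ZZ.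
have act0 o : actW o 0 = 0.
  by have := lin o (-1) 0 0; rewrite scaler0 addr0 scaleN1r addNr.
split=> //=.
- by move=> [n|n|||] c x y /=; rewrite ?lin ?scaler0 ?addr0.
- by move=> n m v; rewrite act0 subrr !scaler0 addr0.
- by move=> n m v; rewrite subrr scaler0.
- by move=> o o' v [->|[->|->]]; case: o' => * /=; rewrite ?act0.
Qed.

Lemma vir_submod P : Lsubmod vir_act P -> Virsubmod actW P.
Proof.
by case=> h h0 hD hZ ho; split=> // -[n|] x Px; [exact: (ho (OD n)) | exact: (ho OZ1)].
Qed.

Lemma vir_simple_hw u h c :
  is_simple_hw_Vir actW u h c -> is_simple_hw vir_act u 0 h c 0 0.
Proof.
case=> HV u0 [up u1 u2] gen [ex sim]; split=> //.
- exact: vir_Lmodule.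
- by split=> //=; [move=> n /up | rewrite scale0r | split; rewrite ?scale0r].
- by move=> P /vir_submod; exact: gen.
- by split=> // P /vir_submod; exact: sim.
Qed.

Lemma vir_tens_simple a b excl :
  tens_simple vir_act a b 0 excl <-> tens_simple_Vir actW a b excl.
Proof.
split=> -[ex sim]; split=> // P HP; apply: sim; case: HP => h h0 hD hZ ho; split=> //.
  move=> [n|n|||] f Pf; try by rewrite (_ : tens_op _ _ _ _ _ _ _ = fun=> 0) //;
    apply: funext => m; rewrite /tens_op /= ?scale0r ?addr0; case: ifP.
  - exact: (ho (VD n)).
  - exact: (ho VZ1).
by move=> [n|] f Pf; [exact: (ho (OD n)) | exact: (ho OZ1)].
Qed.
End Virasoro.

Lemma tens_simple_iso (C : fieldType) (V W : lmodType C) (act : Lop -> V -> V)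
    (actW : Lop -> W -> W) (psi : V -> W) a b F excl :
  linear psi -> (forall o x, psi (act o x) = actW o (psi x)) -> bijective psi ->
  tens_simple act a b F excl -> tens_simple actW a b F excl.
Proof.
move=> lin com [phi psiK phiK] [[f [[[s fs] fx] f0]] sim].
have psi0 : psi 0 = 0 by have := lin (-1) 0 0; rewrite scaler0 addr0 scaleN1r addNr.
have phi0 : phi 0 = 0 by rewrite -psi0 psiK.
have inj0 x : psi x = 0 -> x = 0 by move=> e0; rewrite -(psiK x) e0.
have psiD x y : psi (x + y) = psi x + psi y by have := lin 1 x y; rewrite !scale1r.
have psiZ c x : psi (c *: x) = c *: psi x by have := lin c x 0; rewrite psi0 !addr0.
split.
  exists (psi \o f); split.
    by split=> [|m xm /=]; [exists s => m /fs /= -> | rewrite fx].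
  move=> e; apply: f0; apply: funext => m.
  by rewrite -(psiK (f m)); have := congr1 (@^~ m) e => /= ->.
move=> U [h h0 hD hZ ho].
have [|z|full] := sim (fun f => @tens_space C V excl f /\ U (psi \o f)).
- split=> //.
  + by move=> g [].
  + by split; [split=> //; exists [::] | rewrite (_ : _ \o _ = fun=> 0) //; apply: funext => m /=].
  + move=> g k [[[t gt] gx] Ug] [[[r kr] kx] Uk]; split.
      split=> [|m xm]; last by rewrite gx // kx // addr0.
      by exists (t ++ r) => m; rewrite mem_cat negb_or => /andP[/gt-> /kr->]; rewrite addr0.
    have := hD _ _ Ug Uk; congr U; apply: funext => m /=; by rewrite psiD.
  + move=> c g [[[t gt] gx] Ug]; split.
      split=> [|m xm]; last by rewrite gx // scaler0.
      by exists t => m /gt ->; rewrite scaler0.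
    have := hZ c _ Ug; congr U; apply: funext => m /=; by rewrite psiZ.
  + move=> o g [gT Ug].
    have e : psi \o tens_op act a b F excl o g = tens_op actW a b F excl o (psi \o g).
      apply: funext => m /=; rewrite /tens_op; case: ifP => // _.
      by case: o => [n|n|||]; rewrite ?psiD ?psiZ com.
    have Ue : U (psi \o tens_op act a b F excl o g) by rewrite e; exact: ho.
    split=> //; have [[t gt] gx] := h _ Ue; split=> [|m xm].
      by exists t => m /gt /inj0.
    exact: inj0 (gx m xm).
- left=> g Ug; apply: funext => m.
  have gE : psi \o (phi \o g) = g by apply: funext => k /=; rewrite phiK.
  have [[t gt] gx] := h _ Ug.
  have e : phi \o g = fun=> 0.
    apply: z; split; last by rewrite gE.
    by split=> [|k xk /=]; [exists t => k /gt /= -> | rewrite gx].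
  by rewrite -gE e /= psi0.
- right=> g [[t gt] gx].
  have gE : psi \o (phi \o g) = g by apply: funext => k /=; rewrite phiK.
  have [|_] := full (phi \o g); last by rewrite gE.
  by split=> [|k xk /=]; [exists t => k /gt /= -> | rewrite gx].
Qed.

Lemma A_simple_param (C : fieldType) (a b F : C) : A_simple a b F ->
  F = 0 -> b = 0 \/ b = 1 -> forall m : int, a + m%:~R <> 0.
Proof.
move=> [_ sim] F0 hb m am.
pose x k : int -> C := fun j => (j == k)%:R.
have xf k : finsupp 0 (x k) by exists [:: k] => j; rewrite inE /x => /negbTE ->.
have Ffin o f : finsupp 0 f -> finsupp 0 (Aop a b F o f).
  move=> [s fs]; pose i : int := match o with OD i | OI i => i | _ => 0 end.
  exists [seq k + i | k <- s] => k ki.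
  have kis : k - i \notin s by apply: contra ki => h; apply/mapP; exists (k - i); rewrite ?subrK.
  by case: o @i ki kis => [j|j|||] //= _ h; rewrite fs ?mulr0.
have x1 k : x k k = 1 by rewrite /x eqxx.
have xneq0 k : x k <> fun=> 0.
  by move=> /(congr1 (@^~ k)); rewrite x1 => /eqP; rewrite oner_eq0.
have finD f g : finsupp 0 f -> finsupp 0 g -> finsupp 0 (fun m : int => f m + g m : C).
  move=> [s fs] [t gt]; exists (s ++ t) => k.
  by rewrite mem_cat negb_or => /andP[/fs-> /gt->]; rewrite addr0.
have finZ c f : finsupp 0 f -> finsupp 0 (fun m : int => c * f m : C).
  by move=> [s fs]; exists s => k /fs ->; rewrite mulr0.
have fin0 : finsupp 0 (fun=> 0 : C) by exists [::].
case: hb => b0.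
(* For b = 0, x^m spans a proper submodule, since d_n x^m has coefficient a + m = 0. *)
- have [|z|full] := sim (fun f => finsupp 0 f /\ forall k, k != m -> f k = 0).
  + split=> //.
    * by move=> f [].
    * by move=> f g [ff fz] [gf gz]; split; [exact: finD | move=> k km; rewrite fz // gz // addr0].
    * by move=> c f [ff fz]; split; [exact: finZ | move=> k km; rewrite fz // mulr0].
    * move=> o f [ff fz]; split; first exact: Ffin.
      case: o => [n|n|||] k km //=; last by rewrite F0 mul0r.
      case: (k - n =P m) => [->|/eqP kn]; last by rewrite fz // mulr0.
      by rewrite am b0 mulr0 addr0 mul0r.
  + apply: (xneq0 m); apply: z; split=> // k /negbTE km; by rewrite /x km.
  + have [_ /(_ (m + 1))] := full _ (xf (m + 1)).
    have /negbTE -> : m + 1 != m by apply/eqP; lia.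
    by rewrite x1 => /(_ isT) /eqP; rewrite oner_eq0.
(* For b = 1, the x^k with k <> m span a proper submodule, since d_n x^(m-n) has coefficient a + m =
   0. *)
- have [|z|full] := sim (fun f => finsupp 0 f /\ f m = 0).
  + split=> //.
    * by move=> f [].
    * by move=> f g [ff fz] [gf gz]; split; [exact: finD | rewrite fz gz addr0].
    * by move=> c f [ff fz]; split; [exact: finZ | rewrite fz mulr0].
    * move=> o f [ff fz]; split; first exact: Ffin.
      case: o => [n|n|||] //=; last by rewrite F0 mul0r.
      by rewrite b0 mulr1 -addrA -intrD subrK am mul0r.
  + apply: (xneq0 (m + 1)); apply: z; split=> //; rewrite /x.
    by have /negbTE -> : m != m + 1 by apply/eqP; lia.
  + have [_] := full _ (xf m).
    by rewrite x1 => /eqP; rewrite oner_eq0.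
Qed.

Lemma CC_char0 (n : int) : n%:~R = 0 :> CC -> n = 0.
Proof. by move=> h; apply/eqP; rewrite -(intr_eq0 (Rdefinitions.R[i]%C)); apply/eqP. Qed.

Lemma tens_simple_I0 (C : fieldType) (a b F d0 z1 : C) (V : lmodType C)
    (act : Lop -> V -> V) (w : V) :
  (forall n : int, n%:~R = 0 :> C -> n = 0) -> F <> 0 ->
  is_simple_hw act w 0 d0 z1 0 0 -> tens_simple act a b F (exclA' a b F).
Proof.
move=> char0 F0 Hs; have Hx m : exclA' a b F m -> [/\ a + m%:~R = 0, b = 0 & F = 0].
  by rewrite /exclA'; case: eqP.
apply: (tens_simple_criterion char0 Hs Hx) => // W HW [M HM] m.
have HL : is_Lmodule act by case: Hs.
case: (lerP M m) => [|mM]; first exact: HM.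
(* As the I_n vanish on V, I_{m-M} takes w x^M directly to F w x^m. *)
have := tsub_op HW (OI (m - M)) (HM M (lexx M)).
rewrite (op_pureI HL Hx) (OI_act0 char0 Hs) // linear0 add0r addrCA subrr addr0.
by move/(tsubZ HW F^-1); rewrite scalerA mulVf ?scale1r //; apply/eqP.
Qed.

Lemma tens_simple_iff (C : fieldType) (a b F I0 d0 z1 z2 z3 : C) (excl : int -> bool)
    (V : lmodType C) (act : Lop -> V -> V) (w : V)
    (M : lmodType C) (actM : Lop -> M -> M) (wM : M) (Q1 Q2 : Usum C) :
  (forall n : int, n%:~R = 0 :> C -> n = 0) ->
  (forall m, excl m -> [/\ a + m%:~R = 0, b = 0 & F = 0]) ->
  (F = 0 -> b = 0 \/ b = 1 -> forall m, a + m%:~R = 0 -> excl m) ->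
  is_simple_hw act w I0 d0 z1 z2 z3 -> is_verma actM wM I0 d0 z1 z2 z3 ->
  Uhomog Q1 -> Uhomog Q2 -> maxsub_gen actM wM Q1 Q2 ->
  tens_simple act a b F excl <->
  forall n, ~ excl n -> (rho a b F n Q1, rho a b F n Q2) <> (0, 0).
Proof.
move=> char0 Hx xP Hs HM h1 h2 Hmax; split=> [simT n nx [r1 r2]|].
  have [phi [lin com pw]] := simple_dual Hs HM Hmax h1 h2 r1 r2.
  exact: (tens_not_simple char0 Hs Hx lin com pw nx simT).
have [e1 e2] := Uact_max Hs HM Hmax.
exact: (tens_simple_if char0 Hs Hx xP h1 h2 e1 e2).
Qed.

Theorem theorem26 (a b F I0 d0 z1 z2 z3 : CC) :
  (* (1) *)
  (F <> 0 ->
   forall (V : lmodType CC) (act : Lop -> V -> V) (w : V),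
     is_simple_hw act w 0 d0 z1 0 0 ->
     tens_simple act a b F (exclA' a b F))
  /\
  (* (2) *)
  (forall (V : lmodType CC) (act : Lop -> V -> V) (w : V),
     is_simple_hw act w 0 d0 z1 0 0 ->
   forall (W : lmodType CC) (actW : Virop -> W -> W) (u : W),
     is_simple_hw_Vir actW u d0 z1 ->
     (tens_simple act a b 0 (exclA' a b 0) <->
      tens_simple_Vir actW a b (exclA' a b 0)))
  /\
  (* (3) *)
  ((I0, z2, z3) <> (0, 0, 0) -> A_simple a b F ->
   forall (V : lmodType CC) (act : Lop -> V -> V) (w : V),
     is_simple_hw act w I0 d0 z1 z2 z3 ->
   forall (M : lmodType CC) (actM : Lop -> M -> M) (wM : M),
     is_verma actM wM I0 d0 z1 z2 z3 ->
   forall Q1 Q2 : Usum CC, Uhomog Q1 -> Uhomog Q2 ->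
     maxsub_gen actM wM Q1 Q2 ->
     (tens_simple act a b F exclA <->
      forall n : int, (rho a b F n Q1, rho a b F n Q2) <> (0, 0)))
  /\
  (* (4) *)
  ((I0, z2, z3) <> (0, 0, 0) ->
   forall (V : lmodType CC) (act : Lop -> V -> V) (w : V),
     is_simple_hw act w I0 d0 z1 z2 z3 ->
   forall (M : lmodType CC) (actM : Lop -> M -> M) (wM : M),
     is_verma actM wM I0 d0 z1 z2 z3 ->
   forall Q1 Q2 : Usum CC, Uhomog Q1 -> Uhomog Q2 ->
     maxsub_gen actM wM Q1 Q2 ->
     (tens_simple act 0 0 0 (exclA' (0 : CC) 0 0) <->
      forall n : int, n <> 0 -> (rho 0 0 0 n Q1, rho 0 0 0 n Q2) <> (0, 0))).
Proof.
split; [|split; [|split]].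
- by move=> F0 V act w; exact: tens_simple_I0 CC_char0 F0.
- move=> V act w Hs W actW u /vir_simple_hw Hu.
  rewrite -vir_tens_simple; split.
    have [psi [lin com bij]] := simple_hw_uniq CC_char0 Hs Hu.
    exact: tens_simple_iso lin com bij.
  have [psi [lin com bij]] := simple_hw_uniq CC_char0 Hu Hs.
  exact: tens_simple_iso lin com bij.
- move=> _ As V act w Hs M actM wM HM Q1 Q2 h1 h2 Hmax.
  (* Simplicity of A(a,b;F) rules out the parameters for which an x^m would have to be removed. *)
  have xP : F = 0 -> b = 0 \/ b = 1 -> forall m, a + m%:~R = 0 -> exclA m.
    by move=> F0 hb m /(A_simple_param As F0 hb).
  rewrite (tens_simple_iff CC_char0 _ xP Hs HM h1 h2 Hmax) //.
  by split=> H n; [apply: H | move=> _; apply: H].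
- move=> _ V act w Hs M actM wM HM Q1 Q2 h1 h2 Hmax.
  have xE n : exclA' (0 : CC) 0 0 n <-> n = 0.
    rewrite /exclA' !eqxx add0r /=; split=> [/eqP/CC_char0 //|->]; exact: eqxx.
  have Hx m : exclA' (0 : CC) 0 0 m -> [/\ 0 + m%:~R = 0 :> CC, 0 = 0 :> CC & 0 = 0 :> CC].
    by move=> /xE ->; rewrite addr0.
  have xP : 0 = 0 :> CC -> 0 = 0 :> CC \/ 0 = 1 :> CC ->
      forall m, 0 + m%:~R = 0 :> CC -> exclA' (0 : CC) 0 0 m.
    by move=> _ _ m; rewrite add0r => /CC_char0/xE.
  rewrite (tens_simple_iff CC_char0 Hx xP Hs HM h1 h2 Hmax) //.
  by split=> H n nx; apply: H => /xE.
Qed.
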